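(* For every $\alpha>0$ there exists $\ell_0>0$ such that the following holds for every integer $\ell\ge\ell_0$. Let $p=p(n)$ satisfy $p=\omega(1/n)$, i.e. $p(n)\,n\to\infty$, and for each $n$ let $G_\alpha=G_\alpha(n)$ be any $n$-vertex graph on vertex set $[n]$ with minimum degree $\delta(G_\alpha)\ge\alpha n$. Then asymptotically almost surely (i.e. with probability tending to $1$ as $n\to\infty$) the graph $G_\alpha\cup G(n,p)$ is $\mathcal{F}^\ell(n,2)$-universal.
   Context: $G(n,p)$ denotes the binomial random graph on vertex set $[n]$ in which each pair of vertices is an edge independently with probability $p$; $G_\alpha\cup G(n,p)$ is the graph on $[n]$ whose edge set is the union of the two edge sets. $\mathcal{F}^\ell(n,2)$ is the family of all $n$-vertex graphs with maximum degree at most $2$ and girth at least $\ell$ (i.e. containing no cycle of length less than $\ell$). A graph $G$ is $\mathcal{F}$-universal if it contains every $F\in\mathcal{F}$ as a (not necessarily induced) subgraph. *)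

(* Defs.v *)
From HB Require Import structures.
From mathcomp Require Import all_boot all_order all_algebra.
From mathcomp Require Import boolp reals.

Set Implicit Arguments.
Unset Strict Implicit.
Unset Printing Implicit Defensive.

Import Order.TTheory GRing.Theory Num.Theory.

Local Open Scope ring_scope.

Record sgraph (V : finType) := SGraph {
  adj : rel V;
  adj_sym : symmetric adj;
  adj_irr : irreflexive adj }.

Section Graphs.
Variable V : finType.
Implicit Types (G H : sgraph V) (v : V).

Definition deg G v : nat := #|[pred u | adj G v u]|.

Definition max_degree G : nat := (\max_v deg G v)%N.

(* Every degree is smaller than #|V|, so the default value only matters on the
   empty vertex set, where it is 0. *)
Definition min_degree G : nat := \big[minn/#|V|]_v deg G v.

(* A cycle is a sequence of at least three distinct vertices, cyclically
   consecutive ones being adjacent; [ucycle] alone also accepts sequences of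
   length 0 and 2. *)
Definition girth_at_least (l : nat) G : Prop :=
  forall c : seq V, (3 <= size c)%N -> ucycle (adj G) c -> (l <= size c)%N.

Lemma union_sym G H : symmetric [rel u v | adj G u v || adj H u v].
Proof. by move=> u v /=; rewrite (adj_sym G) (adj_sym H). Qed.

Lemma union_irr G H : irreflexive [rel u v | adj G u v || adj H u v].
Proof. by move=> u /=; rewrite !adj_irr. Qed.

Definition graph_union G H : sgraph V :=
  SGraph (union_sym G H) (union_irr G H).

End Graphs.

Definition subgraph_of (V W : finType) (F : sgraph V) (G : sgraph W) : Prop :=
  exists f : V -> W, injective f /\
    forall u v, adj F u v -> adj G (f u) (f v).

Definition graph_family := forall V : finType, sgraph V -> Prop.

Definition universal (Fam : graph_family) (W : finType) (G : sgraph W) : Prop :=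
  forall (V : finType) (F : sgraph V), Fam V F -> subgraph_of F G.

Definition bounded_degree_girth (l n d : nat) : graph_family :=
  fun V F => [/\ #|V| = n, (max_degree F <= d)%N & girth_at_least l F].

Section BinomialRandomGraph.
Variable n : nat.

Definition pairs : {set {set 'I_n}} := [set e : {set 'I_n} | #|e| == 2%N].

Section EdgeSet.
Variable E : {set {set 'I_n}}.

Definition edge_rel : rel 'I_n := [rel u v | (u != v) && ([set u; v] \in E)].

Lemma edge_rel_sym : symmetric edge_rel.
Proof. by move=> u v; rewrite /edge_rel /= eq_sym finset.setUC. Qed.

Lemma edge_rel_irr : irreflexive edge_rel.
Proof. by move=> u; rewrite /edge_rel /= eqxx. Qed.

Definition graph_of_edges : sgraph 'I_n := SGraph edge_rel_sym edge_rel_irr.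

End EdgeSet.

Variables (R : realType) (p : R).

Definition gnp_weight (E : {set {set 'I_n}}) : R :=
  \prod_(e in pairs) (if e \in E then p else 1 - p).

(* The probability that G(n,p) satisfies A. *)
Definition gnp_prob (A : sgraph 'I_n -> Prop) : R :=
  \sum_(E in powerset pairs | `[< A (graph_of_edges E) >]) gnp_weight E.

End BinomialRandomGraph.

(* Main.v *)
Require Import Defs.
From HB Require Import structures.
From mathcomp Require Import all_classical all_reals all_analysis.
From mathcomp Require Import all_boot all_order all_algebra all_fingroup.
From mathcomp Require Import zify ring lra.

(* A graph with no edge-free pair of disjoint s-sets ("s-joined") has a path Q
   missing at most 2s vertices, by depth-first search. As p n -> oo, H = G(n,p)
   is s-joined for s = c n except with probability at most 4^n (1-p)^(s^2).
   The law of H is invariant under relabelling, so Q may be relabelled by a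
   uniform permutation; then, for all vertices u and v, linearly many of the
   disjoint triples (c, y, d) of consecutive vertices of Q have c, d adjacent to
   v and y adjacent to u in G. In such a triple v can replace y, which becomes
   free to serve as a neighbour of u.

   A graph F of maximum degree 2 and large girth is cut into few blocks, each
   made of a pair of consecutive vertices (x, x') and a segment. Place the
   segments along Q, in order, and the pairs on the uncovered vertices. Now swap
   each uncovered vertex with the middle of a suitable triple: the middles y, y'
   replacing a pair are chosen adjacent in G to the ends of the two segments they
   link, and to each other in H, which is possible since H is s-joined. *)

Set Implicit Arguments.
Unset Strict Implicit.
Unset Printing Implicit Defensive.

Import Order.TTheory GRing.Theory Num.Theory.
Import numFieldNormedType.Exports.

(** * Depth-first search and long paths in joined graphs *)

Definition joined (V : finType) (s : nat) (e : rel V) : Prop :=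
  forall A B : {set V}, [disjoint A & B] -> s <= #|A| -> s <= #|B| ->
  exists a b, [/\ a \in A, b \in B & e a b].

(* Depth-first search: [P] is the stack, [U] the set of unvisited vertices, and
   no edge joins [U] to the set of finished vertices. *)
Lemma dfs_state (V : finType) (e : rel V) (k : nat) :
  symmetric e -> k <= #|V| ->
  exists (U : {set V}) (P : seq V),
    [/\ uniq P, sorted e P, {in P, forall x, x \notin U},
        forall d u, d \notin U -> d \notin P -> u \in U -> ~~ e d u
      & k + 2 * #|U| + size P = 2 * #|V|].
Proof.
move=> e_sym; elim: k => [|k IHk] lekV.
  exists [set: V], [::]; split=> //=; last by rewrite cardsT add0n addn0.
  by move=> d u; rewrite inE.
have [U [P [uP sP PU noe cnt]]] := IHk (ltnW lekV).
have leP : size P <= #|V| by rewrite -(card_uniqP uP) max_card.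
(* With [U] empty the count would put more than [#|V|] vertices on the stack. Each case below lowers
   [2 * #|U| + size P] by one: a vertex of [U] is pushed, or the top of the stack is popped. *)
have U_gt0 : 0 < #|U| by lia.
case: P uP sP PU noe cnt leP => [|p P] uP sP PU noe cnt leP.
  have /card_gt0P [u uU] := U_gt0.
  exists (U :\ u), [:: u]; split=> //=.
  - by move=> x; rewrite inE => /eqP->; rewrite !inE eqxx.
  - move=> d v; rewrite !inE negb_and negbK => /orP [/eqP->|dU]; first by rewrite eqxx.
    by move=> _ /andP [_ vU]; apply: noe.
  - by move: cnt; rewrite (cardsD1 u U) uU /=; lia.
have [/existsP [u /andP [uU epu]]|] := boolP [exists u, (u \in U) && e p u].
  exists (U :\ u), [:: u, p & P]; split=> //.
  - rewrite cons_uniq uP andbT; apply/negP => /PU; by rewrite uU.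
  - by rewrite /= e_sym epu.
  - move=> x; rewrite in_cons => /orP [/eqP->|/PU xU]; first by rewrite !inE eqxx.
    by rewrite !inE negb_and xU orbT.
  - move=> d v dU dP /setD1P [_ vU].
    have /andP [ndu dpP] : (d != u) && (d \notin p :: P) by rewrite -negb_or -in_cons.
    by apply: noe dpP vU; apply: contra dU => dU; apply/setD1P.
  - by move: cnt; rewrite (cardsD1 u U) uU /=; lia.
rewrite negb_exists => /forallP nou.
exists U, P; split=> //.
- by move: uP => /andP [].
- by move: sP => /path_sorted.
- by move=> x xP; apply: PU; rewrite inE xP orbT.
- move=> d u dU dP uU; have [->|ndp] := eqVneq d p.
    by move: (nou u); rewrite uU.
  by apply: noe => //; rewrite inE negb_or ndp.
- by move: cnt => /=; lia.
Qed.

(** After [#|V|] steps of the search the count reads [2 * #|U| + size P = #|V|], so there are as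
    many finished as unvisited vertices. No edge joins these two sets, so each has fewer than [s]
    vertices. *)
Lemma joined_long_path (V : finType) (s : nat) (e : rel V) :
  symmetric e -> joined s e ->
  exists Q : seq V, [/\ uniq Q, sorted e Q & #|V| <= size Q + 2 * s].
Proof.
move=> e_sym e_joined.
have [U [P [uP sP PU noe cnt]]] := dfs_state e_sym (leqnn #|V|).
exists P; split=> //.
suff : #|U| < s by lia.
rewrite ltnNge; apply/negP => leU.
pose D := ~: (U :|: [set x in P]).
have cD : #|D| = #|U|.
  have := cardsC (U :|: [set x in P]); rewrite -/D cardsU.
  have -> : U :&: [set x in P] = set0.
    apply/setP => x; rewrite !inE; apply/negP => /andP [xU xP].
    by have := PU _ xP; rewrite xU.
  by rewrite cards0 cardsE (card_uniqP uP); lia.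
have [||a [b [aD bU eab]]] := e_joined D U _ _ leU; last 1 first.
- move: aD; rewrite !inE negb_or => /andP [aU aP].
  by have := noe a b aU aP bU; rewrite eab.
- by rewrite disjoint_subset; apply/subsetP => x; rewrite !inE negb_or => /andP [].
- by rewrite cD.
Qed.

(* A connector ((t, x), (x', s)) joins the end t of a segment to the start s of
   another one through the pair of vertices x, x'. *)
Definition inner {T : Type} (c : T * T * (T * T)) := [:: c.1.2; c.2.1].
Definition outer {T : Type} (c : T * T * (T * T)) := [:: c.1.1; c.2.2].
Definition links {T : Type} (c : T * T * (T * T)) :=
  [:: (c.1.1, c.1.2); (c.1.2, c.2.1); (c.2.1, c.2.2)].

(** * Swapping uncovered vertices with middles of triples *)

Section Swapping.
Variables (V : finType) (g h : rel V).
Implicit Type Q : seq V.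

Definition is_middle Q m (y : V) :=
  [&& y \in Q, index y Q < 3 * m & index y Q %% 3 == 1].

(* Middles [y] of triples of [Q] where [v] can replace [y] and [y] is adjacent to [u]. *)
Definition middles Q m (u v : V) : {set V} :=
  [set y | [&& is_middle Q m y, g v (nth y Q (index y Q).-1),
               g v (nth y Q (index y Q).+1) & g u y]].

(* The greedy choice: [B] collects the middles that must not be moved, namely the
   ends of segments and those already in use. *)
Lemma swap_perm s m Q (T : nat) (conns : seq (V * V * (V * V))) (B : {set V}) :
  joined s h -> (forall u v, T <= #|middles Q m u v|) ->
  uniq (flatten (map inner conns)) ->
  {in flatten (map inner conns), forall q, 3 * m <= index q Q} ->
  #|B| + 2 * size conns + 2 * s <= T ->
  exists phi : {perm V},
    (forall x, [\/ phi x = x,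
       x \in flatten (map inner conns) /\ is_middle Q m (phi x) && (phi x \notin B)
     | [/\ phi x \in flatten (map inner conns), x \notin B
         & exists u, x \in middles Q m u (phi x)]]) /\
    {in conns, forall c,
       [/\ g c.1.1 (phi c.1.2), h (phi c.1.2) (phi c.2.1) & g c.2.2 (phi c.2.1)]}.
Proof.
(* Think of [x] as a place and of [phi x] as the vertex put there. A place is unchanged, or it
   belonged to a pair and receives a middle, or it is a middle and receives a vertex of a pair that
   can replace it. *)
move=> hj hT; elim: conns B => [|c ls IH] B uL idxL cnt.
  by exists 1%g; split=> // x; constructor 1; rewrite perm1.
set q := c.1.2; set q' := c.2.1.
set Y := middles Q m c.1.1 q :\: B; set Y' := middles Q m c.2.2 q' :\: B.
have cY : 2 * s <= #|Y|.
  have := hT c.1.1 q; rewrite -(cardsID B); have := subset_leq_card (subsetIr (middles Q m c.1.1 q) B).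
  by rewrite /Y; move: cnt => /=; lia.
have cY' : 2 * s <= #|Y'|.
  have := hT c.2.2 q'; rewrite -(cardsID B); have := subset_leq_card (subsetIr (middles Q m c.2.2 q') B).
  by rewrite /Y'; move: cnt => /=; lia.
(* Trimming [Y] to exactly [s] vertices leaves at least [s] vertices in [Y' :\: Y1], so [joined]
   applies to two disjoint sets. *)
have [Y1 /subsetP sY1 cY1] : exists2 Z : {set V}, Z \subset Y & #|Z| = s.
  have les : s <= #|Y| by lia.
  exists [set x in take s (enum Y)].
    by apply/subsetP => x; rewrite inE => /mem_take; rewrite mem_enum.
  by rewrite cardsE (card_uniqP (take_uniq _ (enum_uniq _))) size_takel // -cardE.
have [|||y [y' [yY1 yY' hyy']]] := hj Y1 (Y' :\: Y1) _ _ _.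
- rewrite disjoint_subset; apply/subsetP => x xY1; by rewrite !inE xY1.
- by rewrite cY1.
- have := cY'; rewrite -(cardsID Y1); have := subset_leq_card (subsetIr Y' Y1); lia.
have nyy' : y != y' by apply: contraTneq yY' => <-; rewrite inE yY1.
move/sY1: yY1; rewrite !inE => /andP [yB ymid].
move: yY'; rewrite !inE => /and3P [_ y'B y'mid].
move: uL idxL; rewrite /= !inE !negb_or -/q -/q' => /andP [/andP [nqq' qL] /andP [q'L uL]] idxL.
have qI : 3 * m <= index q Q by apply: idxL; rewrite inE eqxx.
have q'I : 3 * m <= index q' Q by apply: idxL; rewrite !inE eqxx orbT.
have lI : {in flatten (map inner ls), forall q, 3 * m <= index q Q}.
  by move=> x xl; apply: idxL; rewrite !inE xl !orbT.
have mI x : is_middle Q m x -> index x Q < 3 * m by case/and3P.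
(* Once [y] and [y'] are protected, the permutation given by induction fixes them, and it fixes [q]
   and [q'] as well. Composing it with the transpositions of [q, y] and of [q', y'] therefore
   changes it at these four points only. *)
have [|phi [Hphi Hls]] := IH (B :|: [set y; y']) uL lI.
  have leB : #|B :|: [set y; y']| <= #|B| + 2.
    by rewrite (leq_trans (leq_card_setU _ _)) // cards2 nyy'.
  by apply: leq_trans cnt; rewrite /= mulnS addnA !leq_add2r.
have ym : is_middle Q m y by case/and4P: ymid.
have y'm : is_middle Q m y' by case/and4P: y'mid.
have ne x z : is_middle Q m x -> 3 * m <= index z Q -> (x == z = false) * (z == x = false).
  move=> /mI xm zm; have E : (x == z) = false by apply: contraTF zm => /eqP <-; rewrite -ltnNge.
  by rewrite [z == x]eq_sym E.
have nm z : 3 * m <= index z Q -> ~~ is_middle Q m z.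
  by move=> zI; apply/negP => /mI; rewrite ltnNge zI.
have fixq z : 3 * m <= index z Q -> z \notin flatten (map inner ls) -> phi z = z.
  move=> zI zl; case: (Hphi z) => [//|[zl' _]|[_ _ [u]]]; first by rewrite zl' in zl.
  by rewrite inE (negPf (nm _ zI)).
have fixy z : is_middle Q m z -> z \in B :|: [set y; y'] -> phi z = z.
  move=> zm zB; case: (Hphi z) => [//|[/lI]|[_]]; last by rewrite zB.
  by rewrite leqNgt mI.
have fq := fixq _ qI qL; have fq' := fixq _ q'I q'L.
have fy : phi y = y by apply: fixy; rewrite // !inE eqxx orbT.
have fy' : phi y' = y' by apply: fixy; rewrite // !inE eqxx !orbT.
pose psi := (phi * tperm q y * tperm q' y')%g.
have psiE x : psi x = tperm q' y' (tperm q y (phi x)) by rewrite !permM.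
have pq : psi q = y.
  by rewrite psiE fq tpermL tpermD // eq_sym (ne y q', negPf nyy') // negbT // eq_sym.
have pq' : psi q' = y'.
  by rewrite psiE fq' [tperm q y _]tpermD ?tpermL // ?(ne _ _ ym q'I).
have py : psi y = q.
  by rewrite psiE fy tpermR tpermD // ?(ne _ _ y'm qI) // eq_sym.
have py' : psi y' = q'.
  by rewrite psiE fy' [tperm q y _]tpermD ?tpermR // eq_sym ?(ne _ _ y'm qI) // eq_sym.
have keep x : [&& x != q, x != q', x != y & x != y'] -> tperm q' y' (tperm q y x) = x.
  by case/and4P=> *; rewrite [tperm q y x]tpermD 1?eq_sym // tpermD // eq_sym.
have keepM x : is_middle Q m (phi x) -> phi x \notin B :|: [set y; y'] -> psi x = phi x.
  move=> xm; rewrite !inE !negb_or => /and3P [_ n1 n2].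
  by rewrite psiE keep // (ne _ _ xm qI) (ne _ _ xm q'I) n1 n2.
exists psi; split=> [x|].
  have [->|nxq] := eqVneq x q; first by rewrite pq; constructor 2; rewrite ym yB !inE eqxx.
  have [->|nxq'] := eqVneq x q'; first by rewrite pq'; constructor 2; rewrite y'm y'B !inE eqxx orbT.
  have [->|nxy] := eqVneq x y.
    by rewrite py; constructor 3; split; rewrite ?inE ?eqxx //; exists c.1.1; rewrite inE.
  have [->|nxy'] := eqVneq x y'.
    by rewrite py'; constructor 3; split; rewrite ?inE ?eqxx ?orbT //; exists c.2.2; rewrite inE.
  case: (Hphi x) => [fx|[xl /andP [xm xB]]|[xl xB [u xu]]].
  - by constructor 1; rewrite psiE fx keep // nxq nxq' nxy.
  - constructor 2; rewrite keepM //; split; first by rewrite !inE xl !orbT.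
    by rewrite xm; move: xB; rewrite !inE !negb_or => /andP [].
  - have -> : psi x = phi x.
      rewrite psiE keep //; apply/and4P; split.
      + by apply: contraNneq qL => <-.
      + by apply: contraNneq q'L => <-.
      + by rewrite (ne y) // lI.
      + by rewrite (ne y') // lI.
    constructor 3; split; [by rewrite !inE xl !orbT| |by exists u].
    by move: xB; rewrite !inE !negb_or => /andP [].
move=> d; rewrite inE => /orP [/eqP->|dls].
  rewrite -/q -/q' pq pq'; split=> //; [by case/and4P: ymid|by case/and4P: y'mid].
have inn z : z \in inner d -> z \in flatten (map inner ls).
  by move=> zd; apply/flattenP; exists (inner d) => //; apply: map_f.
have stay z : z \in inner d -> psi z = phi z.
  move=> /inn zl; have zI := lI _ zl.
  case: (Hphi z) => [fz|[_ /andP [zm zB]]|[_ _ [u]]].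
  - rewrite psiE fz keep // (ne y z) // (ne y' z) // !andbT; apply/andP; split.
      by apply: contraNneq qL => <-.
    by apply: contraNneq q'L => <-.
  - exact: keepM.
  - by rewrite inE (negPf (nm _ zI)).
by rewrite !stay ?inE ?eqxx ?orbT //; apply: Hls.
Qed.

End Swapping.

(** * Cutting paths and cycles into pairs and segments *)

Section Blueprint.
Variable V : finType.
Implicit Types (S c : seq V) (cs : seq (V * V * (V * V))).

(* The edges needed when the vertices of [S] are placed along a path, in order. *)
Definition blueprint_rel S cs : rel V :=
  fun u v => infix [:: u; v] S || has (fun d => (u, v) \in links d) cs.

Lemma blueprint_rel_sub S S' cs cs' :
  infix S S' -> subseq cs cs' -> subrel (blueprint_rel S cs) (blueprint_rel S' cs').
Proof.
move=> iS scs u v /orP [iuv|/hasP [d dcs uvd]]; apply/orP; first by left; apply: infix_trans iS.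
by right; apply/hasP; exists d => //; apply: (mem_subseq scs).
Qed.

Lemma path_infix S z c : path (fun u v => infix [:: u; v] (S ++ z :: c)) z c.
Proof.
elim: c S z => //= x c IHc S z; apply/andP; split.
  by apply/infixP; exists S, c.
by have := IHc (rcons S z) x; rewrite cat_rcons.
Qed.

(** Blocks of [l] vertices are split off from the left, and the last block absorbs the remainder.
    The vertex [t] is the end of the preceding segment, where the first connector starts. A block
    has more than two vertices, so a nonempty segment follows its pair and the next connector has an
    end to start from. *)
Lemma chop_path (l h : nat) (t : V) c :
  2 < l -> h.+1 * l <= size c < h.+2 * l ->
  exists S cs, [/\ perm_eq c (S ++ flatten (map inner cs)), size cs = h.+1,
    path (blueprint_rel S cs) t c, {subset flatten (map outer cs) <= t :: S}
  & last t c \in S].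
Proof.
move=> l_gt2; elim: h t c => [|h IHh] t c /andP [le_c c_lt].
  case: c le_c c_lt => [|x [|x' [|z c]]] /=; [lia|lia|lia|move=> _ _].
  exists (z :: c), [:: ((t, x), (x', z))]; split=> //=.
  - by rewrite -[z :: c ++ _]/((z :: c) ++ [:: x; x']) perm_sym perm_catC.
  - rewrite /blueprint_rel /= !inE !eqxx ?orbT /=.
    apply: sub_path (path_infix [::] z c) => u v /= uv; by rewrite uv.
  - by move=> u; rewrite !inE => /orP [->|/eqP->] //; rewrite eqxx orbT.
  - exact: mem_last.
have sz1 : size (take l c) = l by rewrite size_takel //; lia.
rewrite -(cat_take_drop l c).
have szd : size (drop l c) = size c - l by rewrite size_drop.
case: (take l c) sz1 => [|x [|x' [|z s]]] /=; [lia|lia|lia|move=> _].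
have [|S [cs [pe szcs pth sub lst]]] := IHh (last z s) (drop l c).
  by rewrite szd; lia.
exists (z :: s ++ S), (((t, x), (x', z)) :: cs); split=> /=.
- rewrite perm_sym -[z :: (s ++ S) ++ _]/((z :: s ++ S) ++ [:: x; x'] ++ flatten (map inner cs)).
  rewrite perm_catCA -[[:: x, x', z & _]]/([:: x; x'] ++ (z :: s) ++ drop l c) perm_cat2l.
  by rewrite -cat_cons -catA perm_cat2l perm_sym.
- by rewrite szcs.
- rewrite {1 2 3}/blueprint_rel /= !inE !eqxx ?orbT /= cat_path; apply/andP; split.
    apply: sub_path (path_infix [::] z s) => u v uv; apply/orP; left.
    by apply: infix_trans uv _; apply/infixP; exists [::], S.
  apply: sub_path pth; apply: blueprint_rel_sub; last exact: subseq_cons.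
  by apply/infixP; exists (z :: s), [::]; rewrite cats0.
- move=> u; rewrite !inE => /or3P [->//|/eqP->|/sub]; first by rewrite eqxx orbT.
  rewrite inE => /orP [/eqP->|uS]; last by rewrite mem_cat uS !orbT.
  have := mem_last z s; rewrite inE mem_cat => /orP [->|->]; by rewrite ?orbT.
- by rewrite last_cat inE mem_cat lst !orbT.
Qed.

(** A cycle is a path starting at its own last vertex: [chop_path] is applied with [t] the last
    vertex of [c], which lies in the last segment, so all connectors end in [S]. *)
Lemma chop_cycle (l : nat) c :
  2 < l -> l <= size c ->
  exists S cs, [/\ perm_eq c (S ++ flatten (map inner cs)), size cs = size c %/ l,
    path.cycle (blueprint_rel S cs) c & {subset flatten (map outer cs) <= S}].
Proof.
move=> l_gt2 le_c; have l_gt0 : 0 < l by lia.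
case: c le_c => [|x p]; first by rewrite /=; lia.
set c := x :: p => le_c.
have h_gt0 : 0 < size c %/ l by rewrite divn_gt0.
have [|S [cs [pe sz pth sub lst]]] := @chop_path l (size c %/ l).-1 (last x p) c l_gt2.
  rewrite prednK // leq_trunc_div /=; by rewrite ltn_ceil.
exists S, cs; split=> //; first by rewrite sz prednK.
  by rewrite (cycle_path x).
have lS : last x p \in S by move: lst.
by move=> u /sub; rewrite inE => /orP [/eqP->|].
Qed.

End Blueprint.

(** * Blueprints of graphs of maximum degree 2 and large girth *)

Section Decompose.
Variables (V : finType) (F : sgraph V) (l : nat).
Hypotheses (F_deg : max_degree F <= 2) (F_girth : girth_at_least l F).

Lemma no_three_neighbours v a b c :
  adj F v a -> adj F v b -> adj F v c -> uniq [:: a; b; c] -> False.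
Proof.
move=> va vb vc u3.
have : 3 <= deg F v.
  rewrite /deg -[3]/(size [:: a; b; c]) -(card_uniqP u3); apply: subset_leq_card.
  by apply/subsetP => x; rewrite !inE => /or3P [] /eqP->.
apply/negP; rewrite -ltnNge ltnS; apply: leq_trans F_deg.
exact: (leq_bigmax v).
Qed.

Lemma infix_nth (x0 : V) s i : i.+1 < size s -> infix [:: nth x0 s i; nth x0 s i.+1] s.
Proof.
move=> lti; apply/infixP; exists (take i s), (drop i.+2 s).
by rewrite -{1}(cat_take_drop i s) (drop_nth x0) 1?ltnW // (drop_nth x0 lti).
Qed.

(* A longest path inside a nonempty closed set spans a whole component. *)
Lemma component (U : {set V}) :
  U != set0 -> (forall u v, u \in U -> adj F u v -> v \in U) ->
  exists c, [/\ c != [::], uniq c, {subset c <= U}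
    & (forall u v, u \in c -> adj F u v -> infix [:: u; v] c || infix [:: v; u] c) \/
      (l <= size c /\ forall u v, u \in c -> adj F u v ->
          (v \in c) && ((v == next c u) || (u == next c v)))].
Proof.
move=> /set0Pn [u0 u0U] Ucl.
pose P k := `[< exists c : seq V, [/\ size c = k, uniq c, sorted (adj F) c & {subset c <= U}] >].
have exP : exists k, P k.
  by exists 1; apply/asboolP; exists [:: u0]; split=> // x; rewrite inE => /eqP->.
have bdP k : P k -> k <= #|V|.
  by move=> /asboolP [c [<- uc _ _]]; rewrite -(card_uniqP uc) max_card.
case: (ex_maxnP exP bdP) => k /asboolP [c [szc uc sc cU]] kmax.
have k_gt0 : 0 < k.
  by apply: kmax; apply/asboolP; exists [:: u0]; split=> // x; rewrite inE => /eqP->.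
set x0 := u0.
have adjS i : i.+1 < k -> adj F (nth x0 c i) (nth x0 c i.+1).
  by move=> lti; apply: (sortedP x0 sc); rewrite szc.
have adjP i : 0 < i < k -> adj F (nth x0 c i) (nth x0 c i.-1).
  by move=> /andP [i0 ik]; rewrite adj_sym; have := adjS i.-1; rewrite prednK //; apply.
have neq i j : i < k -> j < k -> (nth x0 c i == nth x0 c j) = (i == j).
  by move=> ik jk; rewrite nth_uniq // szc.
(* An inner vertex of the path has two neighbours on it, and the degree bound excludes a third. *)
have inner_nbr i v : 0 < i -> i.+1 < k -> adj F (nth x0 c i) v ->
    v = nth x0 c i.-1 \/ v = nth x0 c i.+1.
  move=> i0 ik av; have [->|n1] := eqVneq v (nth x0 c i.-1); first by left.
  have [->|n2] := eqVneq v (nth x0 c i.+1); first by right.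
  have ip : i.-1 < k by lia.
  exfalso; apply: (@no_three_neighbours (nth x0 c i) v (nth x0 c i.-1) (nth x0 c i.+1)) => //.
  - by apply: adjP; rewrite i0 ltnW.
  - exact: adjS.
  - rewrite /= !inE negb_or n1 n2 /= neq //; lia.
(* A neighbour outside [c] of an end of [c] would extend this longest path, and stay in [U] because
   [U] is closed. *)
have headU v : adj F (nth x0 c 0) v -> v \in c.
  move=> av; apply/negPn/negP => vc.
  suff : k.+1 <= k by rewrite ltnn.
  apply: kmax; apply/asboolP; exists (v :: c); split=> /=.
  - by rewrite szc.
  - by rewrite vc.
  - by case: (c) sc av => //= y s -> av; rewrite adj_sym av.
  - move=> z; rewrite inE => /orP [/eqP->|/cU //].
    by apply: Ucl av; apply: cU; rewrite mem_nth // szc.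
have lastU v : adj F (nth x0 c k.-1) v -> v \in c.
  move=> av; apply/negPn/negP => vc.
  suff : k.+1 <= k by rewrite ltnn.
  apply: kmax; apply/asboolP; exists (rcons c v); split.
  - by rewrite size_rcons szc.
  - by rewrite rcons_uniq vc.
  - move: av; rewrite -szc nth_last; case: (c) sc => //= y s ss av.
    by rewrite rcons_path ss.
  - move=> z; rewrite mem_rcons inE => /orP [/eqP->|/cU //].
    by apply: Ucl av; apply: cU; rewrite mem_nth // szc; lia.
(* Neighbours that are not consecutive on the path can only be its two ends, since inner vertices
   are saturated. *)
have nbr i v : i < k -> adj F (nth x0 c i) v ->
    exists j, [/\ v = nth x0 c j, j < k &
      [\/ j = i.+1, i = j.+1, [/\ i = 0, j = k.-1 & 2 < k] | [/\ j = 0, i = k.-1 & 2 < k]]].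
  move=> ik av; have [/andP [i0 i1]|iend] := boolP ((0 < i) && (i.+1 < k)).
    case: (inner_nbr i v i0 i1 av) => ->.
      by exists i.-1; split=> //; [lia|constructor 2; lia].
    by exists i.+1; split=> //; constructor 1.
  have iE : i = 0 \/ i = k.-1 by lia.
  have vc : v \in c by case: iE av => ->; [exact: headU|exact: lastU].
  exists (index v c); rewrite nth_index // -szc index_mem vc szc; split=> //.
  set j := index v c; have jk : j < k by rewrite -szc index_mem.
  have vE : v = nth x0 c j by rewrite nth_index.
  have nij : i != j.
    by apply: contraTneq av => ij; rewrite vE -ij adj_irr.
  have far : 0 < j -> j.+1 < k -> i = j.-1 \/ i = j.+1.
    move=> j0 j1; have := inner_nbr j (nth x0 c i) j0 j1.
    rewrite -vE adj_sym => /(_ av) [] /eqP; rewrite neq //; [|lia| ]; move=> /eqP; tauto.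
  have : [|| j == i.+1, i == j.+1, [&& i == 0, j == k.-1 & 2 < k] | [&& j == 0, i == k.-1 & 2 < k]].
    by clear -iE far nij jk k_gt0; lia.
  by case/or4P => [/eqP|/eqP|/and3P [/eqP ? /eqP ?]|/and3P [/eqP ? /eqP ?]];
    [constructor 1|constructor 2|constructor 3|constructor 4].
have nextE i : i < k -> next c (nth x0 c i) = nth x0 c (if i.+1 < k then i.+1 else 0).
  move=> ik; rewrite next_nth mem_nth ?szc // index_uniq ?szc //.
  case: (c) szc ik => [|y s] /= szs ik; first by rewrite -szs in ik.
  case: ltnP => lik /=; first by apply: set_nth_default; lia.
  by rewrite nth_default //; lia.
(* If the ends are adjacent, the path closes into a cycle, whose length is bounded below by the
   girth; otherwise the component is a path. *)
have [/andP [k_gt2 wrap]|nowrap] := boolP ((2 < k) && adj F (nth x0 c k.-1) (nth x0 c 0)).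
  exists c; split=> //; first by rewrite -size_eq0 szc -lt0n.
  right; split.
    apply: F_girth; first by rewrite szc.
    rewrite /ucycle uc andbT (cycle_path x0) -(nth_last x0) szc.
    case: (c) sc wrap szc => [|y s] //= ss wr _; apply/andP; split=> //.
  move=> u v uc' auv; have uE : u = nth x0 c (index u c) by rewrite nth_index.
  have iu : index u c < k by rewrite -szc index_mem.
  rewrite uE in auv *; have [j [-> jk]] := nbr _ _ iu auv.
  rewrite mem_nth ?szc //= !nextE //.
  case=> [jE|iE|[i0 jE _]|[j0 iE _]].
  - by rewrite -jE jk eqxx.
  - by rewrite -iE iu eqxx orbT.
  - by rewrite i0 jE prednK // ltnn eqxx orbT.
  - by rewrite iE j0 prednK // ltnn eqxx.
exists c; split=> //; first by rewrite -size_eq0 szc -lt0n.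
left=> u v uc' auv; have uE : u = nth x0 c (index u c) by rewrite nth_index.
have iu : index u c < k by rewrite -szc index_mem.
rewrite uE in auv *; have [j [vE jk]] := nbr _ _ iu auv; rewrite vE.
case=> [jE|iE|[i0 jE k2]|[j0 iE k2]].
- by rewrite jE infix_nth // szc -jE.
- by rewrite orbC [in X in infix X]iE infix_nth // szc -iE.
- by case/negP: nowrap; rewrite k2 /= -jE -vE adj_sym -i0.
- by case/negP: nowrap; rewrite k2 /= -iE -j0 -vE.
Qed.

(* [S] and [cs] account for the cycles of [F] inside [W]; its paths, possibly short,
   are concatenated into [P], to be cut as a whole. *)
Definition blueprint l0 (W : {set V}) S cs P :=
  [/\ uniq (S ++ flatten (map inner cs) ++ P),
      S ++ flatten (map inner cs) ++ P =i W,
      {subset flatten (map outer cs) <= S},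
      l0 * size cs <= #|W| - size P <= 2 * l0 * size cs
    & forall u v, u \in W -> adj F u v ->
        [|| blueprint_rel S cs u v, blueprint_rel S cs v u, infix [:: u; v] P | infix [:: v; u] P]].

(** Components are removed one at a time. A path is prepended to [P], where the junction only asks
    for an edge that [F] does not have. A cycle has at least [l0] vertices by the girth condition,
    so it can be chopped on its own. *)
Lemma blueprint_exists l0 (U : {set V}) :
  2 < l0 <= l -> (forall u v, u \in U -> adj F u v -> v \in U) ->
  exists S cs P, blueprint l0 U S cs P.
Proof.
move=> /andP [l0_gt2 le_l0].
elim: {U}_.+1 {-2}U (ltnSn #|U|) => // n IHn U cU Ucl.
have [->|U0] := eqVneq U set0.
  exists [::], [::], [::]; split=> //=; first by move=> x; rewrite !inE.
    by rewrite cards0 !muln0.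
  by move=> u v; rewrite inE.
have [c [c0 uc cU' cedge]] := component U0 Ucl.
pose W := U :\: [set x in c].
have sizeW : #|U| = size c + #|W|.
  rewrite -(cardsID [set x in c] U); congr (_ + _); rewrite -(card_uniqP uc); apply: eq_card => x.
  by rewrite !inE; case xc: (x \in c); rewrite ?andbF // (cU' _ xc).
have cNbr u v : u \in c -> adj F u v -> v \in c.
  move=> ucc auv; case: cedge => [H|[_ H]]; last by have /andP [] := H _ _ ucc auv.
  by have /orP [] := H _ _ ucc auv => /mem_infix; apply; rewrite !inE eqxx ?orbT.
have Wcl u v : u \in W -> adj F u v -> v \in W.
  rewrite !inE => /andP [nuc uU] auv; rewrite (Ucl _ _ uU auv) andbT.
  by apply: contra nuc => vc; apply: cNbr vc _; rewrite adj_sym.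
have cgt0 : 0 < size c by rewrite lt0n size_eq0.
have [|S [cs [P [uSP SPW out cnt edge]]]] := IHn W _ Wcl; first by lia.
have inU u : (u \in U) = (u \in c) || (u \in W).
  by rewrite !inE; case uc': (u \in c) => //=; apply: cU'.
have dis u : u \in c -> u \notin W by rewrite !inE => ->.
have leP : size P <= #|W|.
  move: uSP; rewrite !cat_uniq => /and3P [_ _ /and3P [_ _ uP]].
  rewrite -(card_uniqP uP); apply: subset_leq_card; apply/subsetP => x xP.
  by rewrite -SPW !mem_cat xP !orbT.
case: cedge => [lin|[lec cyc]].
  exists S, cs, (c ++ P); split=> //.
  - rewrite catA uniq_catCA -catA cat_uniq uc uSP andbT; apply/hasPn => x; rewrite SPW.
    by apply: contraL => /dis.
  - move=> x; rewrite inU -SPW !mem_cat; by do !case: (x \in _).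
  - rewrite size_cat sizeW subnDl //.
  - move=> u v; rewrite inU => /orP [uc' auv|uW auv].
      apply/or4P; case/orP: (lin _ _ uc' auv) => iuv; [constructor 3|constructor 4];
      by apply: infix_trans iuv _; apply/infixP; exists [::], P.
    have iP : infix P (c ++ P) by apply/infixP; exists c, [::]; rewrite cats0.
    case/or4P: (edge _ _ uW auv) => [->|->|i|i]; rewrite ?orbT //;
    by rewrite (infix_trans i iP) ?orbT.
have [S1 [cs1 [pe1 sz1 cyc1 out1]]] := chop_cycle l0_gt2 (leq_trans le_l0 lec).
exists (S1 ++ S), (cs1 ++ cs), P.
have pall : perm_eq ((S1 ++ S) ++ flatten (map inner (cs1 ++ cs)) ++ P)
                    (c ++ S ++ flatten (map inner cs) ++ P).
  apply/seq.permP => a; rewrite map_cat flatten_cat !count_cat (seq.permP pe1) count_cat.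
  by rewrite -!addnA; congr addn; rewrite addnCA.
split.
- rewrite (perm_uniq pall) cat_uniq uc uSP andbT; apply/hasPn => x; rewrite SPW.
  by apply: contraL => /dis.
- by move=> x; rewrite (perm_mem pall) inU -SPW mem_cat.
- move=> x; rewrite map_cat flatten_cat !mem_cat => /orP [/out1->//|/out->]; by rewrite orbT.
(* The number [h = size c %/ l0] of new connectors is positive, so [l0 * h <= size c < l0 * h.+1 <=
   2 * l0 * h]. *)
- rewrite size_cat sizeW -addnBA // sz1.
  have := leq_trunc_div (size c) l0; have : 0 < size c %/ l0 by rewrite divn_gt0 ?(leq_trans le_l0) //; lia.
  have := ltn_ceil (size c) (ltnW (ltnW l0_gt2)); move: (size c %/ l0) cnt => a; clear; nia.
- have b1 : subrel (blueprint_rel S1 cs1) (blueprint_rel (S1 ++ S) (cs1 ++ cs)).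
    by apply: blueprint_rel_sub; [apply/infixP; exists [::], S|exact: prefix_subseq].
  have b2 : subrel (blueprint_rel S cs) (blueprint_rel (S1 ++ S) (cs1 ++ cs)).
    by apply: blueprint_rel_sub; [apply/infixP; exists S1, [::]; rewrite cats0|exact: suffix_subseq].
  move=> u v; rewrite inU => /orP [uc' auv|uW auv].
    have /andP [vc /orP [/eqP ->|/eqP ->]] := cyc _ _ uc' auv.
      by rewrite (b1 _ _ (next_cycle cyc1 uc')).
    by rewrite (b1 _ _ (next_cycle cyc1 vc)) orbT.
  by case/or4P: (edge _ _ uW auv) => [/b2->|/b2->|->|->]; rewrite ?orbT.
Qed.
End Decompose.

(** It remains to cut [P]. If [P] has fewer than [l0] vertices, it is appended to [S] without any
    connector, which accounts for the summand [l0] in the upper bound. Otherwise it is closed up by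
    one extra edge and chopped as a cycle. *)
Lemma blueprint_total (V : finType) (F : sgraph V) (l0 l : nat) :
  2 < l0 <= l -> max_degree F <= 2 -> girth_at_least l F ->
  exists S cs, [/\ perm_eq (S ++ flatten (map inner cs)) (enum V),
    {subset flatten (map outer cs) <= S},
    l0 * size cs <= #|V| < 2 * l0 * size cs + l0
    & forall u v, adj F u v -> blueprint_rel S cs u v || blueprint_rel S cs v u].
Proof.
move=> l0l Fdeg Fg; have /andP [l0_gt2 _] := l0l.
have [//|S [cs [P [uSP SPW out cnt edge]]]] := blueprint_exists Fdeg Fg (U := setT) l0l.
have leP : size P <= #|V|.
  move: uSP; rewrite !cat_uniq => /and3P [_ _ /and3P [_ _ uP]].
  by rewrite -(card_uniqP uP) max_card.
have peV : perm_eq (S ++ flatten (map inner cs) ++ P) (enum V).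
  by apply: uniq_perm => // [|x]; rewrite ?enum_uniq // SPW mem_enum inE.
rewrite cardsT in cnt.
have [ltP|geP] := ltnP (size P) l0.
  exists (S ++ P), cs; split.
  - by apply: perm_trans peV; rewrite -catA perm_cat2l perm_catC.
  - by move=> x /out; rewrite mem_cat => ->.
  - by move: cnt; lia.
  - have b : subrel (blueprint_rel S cs) (blueprint_rel (S ++ P) cs).
      by apply: blueprint_rel_sub => //; apply/infixP; exists [::], P.
    have iP : infix P (S ++ P) by apply/infixP; exists S, [::]; rewrite cats0.
    move=> u v auv; case/or4P: (edge u v (in_setT _) auv) => [/b->|/b->|i|i]; rewrite ?orbT //.
      by rewrite /blueprint_rel (infix_trans i iP).
    by rewrite /blueprint_rel (infix_trans i iP) !orbT.
have [S1 [cs1 [pe1 sz1 cyc1 out1]]] := chop_cycle l0_gt2 geP.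
exists (S1 ++ S), (cs1 ++ cs); split.
- apply/seq.permP => a; rewrite -(seq.permP peV) map_cat flatten_cat !count_cat.
  have := seq.permP pe1 a; rewrite count_cat => ->.
  by rewrite addnACA addnC -addnA.
- move=> x; rewrite map_cat flatten_cat !mem_cat => /orP [/out1->//|/out->]; by rewrite orbT.
- rewrite size_cat sz1.
  have := leq_trunc_div (size P) l0.
  have := ltn_ceil (size P) (ltnW (ltnW l0_gt2)); move: (size P %/ l0) cnt leP => a; clear; nia.
- have b1 : subrel (blueprint_rel S1 cs1) (blueprint_rel (S1 ++ S) (cs1 ++ cs)).
    by apply: blueprint_rel_sub; [apply/infixP; exists [::], S|exact: prefix_subseq].
  have b2 : subrel (blueprint_rel S cs) (blueprint_rel (S1 ++ S) (cs1 ++ cs)).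
    by apply: blueprint_rel_sub; [apply/infixP; exists S1, [::]; rewrite cats0|exact: suffix_subseq].
  have b3 u v : infix [:: u; v] P -> blueprint_rel S1 cs1 u v.
    move=> /infixP [p [s PE]]; have : sorted (blueprint_rel S1 cs1) P.
      by case: (P) cyc1 => //= x q; rewrite rcons_path => /andP [].
    by rewrite PE => /cat_sorted2 [_ /cat_sorted2 [/andP []]].
  move=> u v auv; case/or4P: (edge u v (in_setT _) auv) => [/b2->|/b2->|/b3/b1->|/b3/b1->]; by rewrite ?orbT.
Qed.

(** * The deterministic embedding *)

Lemma flatten_map_inner (T U : Type) (f : T -> U) (cs : seq (T * T * (T * T))) :
  flatten (map inner [seq ((f c.1.1, f c.1.2), (f c.2.1, f c.2.2)) | c <- cs]) =
  map f (flatten (map inner cs)).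
Proof. by elim: cs => //= c cs ->. Qed.

Lemma flatten_map_outer (T U : Type) (f : T -> U) (cs : seq (T * T * (T * T))) :
  flatten (map outer [seq ((f c.1.1, f c.1.2), (f c.2.1, f c.2.2)) | c <- cs]) =
  map f (flatten (map outer cs)).
Proof. by elim: cs => //= c cs ->. Qed.

Lemma size_flatten_inner (T : Type) (cs : seq (T * T * (T * T))) :
  size (flatten (map inner cs)) = 2 * size cs.
Proof. by elim: cs => //= c cs ->; rewrite mulnS. Qed.

Lemma size_flatten_outer (T : Type) (cs : seq (T * T * (T * T))) :
  size (flatten (map outer cs)) = 2 * size cs.
Proof. by elim: cs => //= c cs ->; rewrite mulnS. Qed.

Lemma rearrange (V W : finType) (s : seq V) (t : seq W) (w0 : W) :
  uniq s -> (forall v, v \in s) -> uniq t -> size s = size t ->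
  exists2 f : V -> W, injective f & map f s = t.
Proof.
move=> us sV ut st; exists (fun v => nth w0 t (index v s)).
  move=> u v /eqP; rewrite nth_uniq -?st ?index_mem // => /eqP E.
  by rewrite -(nth_index u (sV u)) E nth_index.
apply: (@eq_from_nth _ w0); rewrite ?size_map // => i lti.
case: (s) us lti st => [|v s'] // us lti st.
by rewrite (nth_map v) // index_uniq.
Qed.

Lemma universal_of_middles (W : finType) (G H : sgraph W) (s m T l0 l : nat) (Q : seq W) :
  joined s (adj H) -> uniq Q -> sorted (adj H) Q -> #|W| <= size Q + 2 * s ->
  (forall u v, T <= #|middles (adj G) Q m u v|) ->
  2 < l0 <= l -> 2 * l0 * s + l0 <= #|W| -> l0 * (3 * m) + 2 * #|W| <= l0 * #|W| ->
  4 * #|W| + 2 * l0 * s <= l0 * T ->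
  universal (bounded_degree_girth l #|W| 2) (graph_union G H).
Proof.
move=> Hj uQ sQ szQ HT l0l num1 num2 num3 V F [cardV Fdeg Fg].
have [S [cs [peS out Kb edge]]] := blueprint_total l0l Fdeg Fg.
set X := flatten (map inner cs) in peS; set K := size cs in Kb.
have l0_gt2 : 2 < l0 by case/andP: l0l.
have szX : size X = 2 * K by exact: size_flatten_inner.
have szSX : size S + 2 * K = #|W|.
  by rewrite -szX -size_cat (perm_size peS) -cardE.
(* The bound [s <= K] makes room for [S] on [Q]; [3 * m <= size S] keeps the triples inside the part
   of [Q] covered by segments. The greedy choice consumes [4 * K + 2 * s]: at most [2 * K] protected
   ends, [2 * K] middles, and [2 * s] for the use of [joined]. *)
have sK : s <= K by rewrite cardV in Kb; nia.
have mN : 3 * m <= size S by rewrite cardV in Kb; nia.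
have TK : 4 * K + 2 * s <= T by rewrite cardV in Kb; nia.
have NQ : size S <= size Q by lia.
have /card_gt0P [w0 _] : 0 < #|W| by lia.
set N := size S in mN NQ szSX.
set Q' := take N Q; have szQ' : size Q' = N by rewrite size_takel.
have uQ' : uniq Q' by rewrite take_uniq.
set L := enum [predC Q'].
have szL : size L = 2 * K.
  have := cardC (mem Q'); rewrite (card_uniqP uQ') szQ' -cardE.
  by rewrite [#|[predC _]|](_ : _ = #|[predC Q']|) //; lia.
have uQL : uniq (Q' ++ L).
  rewrite cat_uniq uQ' enum_uniq andbT; apply/hasPn => x; by rewrite mem_enum.
have uSX : uniq (S ++ X) by rewrite (perm_uniq peS) enum_uniq.
have SXV v : v \in S ++ X by rewrite (perm_mem peS) mem_enum.
have [|f0 f0inj f0E] := rearrange w0 uSX SXV uQL.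
  by rewrite !size_cat szX szQ' szL.
have [f0S f0X] : map f0 S = Q' /\ map f0 X = L.
  have /eqP := f0E; rewrite map_cat eqseq_cat ?size_map ?szQ' //.
  by case/andP => /eqP ? /eqP ?.
pose cs' := [seq ((f0 c.1.1, f0 c.1.2), (f0 c.2.1, f0 c.2.2)) | c <- cs].
have innE : flatten (map inner cs') = L by rewrite flatten_map_inner f0X.
pose B := [set x in flatten (map outer cs')].
have cB : #|B| <= 2 * K.
  rewrite cardsE; apply: leq_trans (card_size _) _.
  by rewrite size_flatten_outer size_map.
(* The set [L] consists of the tail of [Q] and of the vertices off [Q], whose [index] is
   [size Q]. *)
have LQ x : x \in L -> 3 * m <= index x Q.
  rewrite mem_enum inE /= => xQ'; rewrite leqNgt; apply: contra xQ' => lt.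
  have xQ : x \in Q by rewrite -index_mem (leq_trans lt) // (leq_trans mN).
  by rewrite in_take // (leq_trans lt).
have [|||phi [Hphi Hcs]] := @swap_perm W (adj G) (adj H) s m Q T cs' B Hj HT.
- by rewrite innE enum_uniq.
- by move=> x; rewrite innE => /LQ.
- rewrite size_map -/K -addnA; apply: leq_trans TK.
  by rewrite addnA leq_add2r; move: cB; clear; lia.
rewrite innE in Hphi.
have Q'L x : x \in Q' -> x \notin L by rewrite mem_enum inE /= negbK.
have fS u : u \in S -> f0 u \in Q' by rewrite -f0S => uS; apply: map_f.
(* Middles have index 1 modulo 3, so at most one end of an edge of [Q] inside [Q'] is replaced. An
   intact edge comes from [H]; an edge with a replaced end comes from [G], by the choice of the
   middle. *)
have good u v : blueprint_rel S cs u v -> adj (graph_union G H) (phi (f0 u)) (phi (f0 v)).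
  case/orP => [iuv|/hasP [c ccs uvc]].
    have : infix [:: f0 u; f0 v] Q.
      have /infixP [p [q SE]] := iuv.
      apply: (@infix_trans _ Q'); last by apply/infixP; exists [::], (drop N Q); rewrite cat_take_drop.
      by apply/infixP; exists (map f0 p), (map f0 q); rewrite -f0S SE !map_cat.
    have [uS vS] : u \in S /\ v \in S by split; apply: (mem_infix iuv); rewrite !inE eqxx ?orbT.
    move: (fS _ uS) (fS _ vS); set a := f0 u; set b := f0 v => aQ bQ /infixP [p [q QE]].
    have na : nth a Q (size p) = a by rewrite QE nth_cat ltnn subnn.
    have nb : nth a Q (size p).+1 = b by rewrite QE nth_cat ltnNge leqW // subSnn.
    have lt : (size p).+1 < size Q by rewrite QE !size_cat /=; lia.
    have ia : index a Q = size p by rewrite -{1}na index_uniq // ltnW.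
    have ib : index b Q = (size p).+1 by rewrite -{1}nb index_uniq.
    case: (Hphi a) => [->|[aL]|[aL aB [w]]]; [|by rewrite (negPf (Q'L _ aQ)) in aL|].
      case: (Hphi b) => [->|[bL]|[bL bB [w]]]; [|by rewrite (negPf (Q'L _ bQ)) in bL|].
        by have := elimT (sortedP a) sQ _ lt; rewrite na nb /= => ->; rewrite orbT.
      rewrite inE ib (set_nth_default a) ?na 1?ltnW // => /and4P [_ Gb _ _].
      by rewrite /= adj_sym Gb.
    rewrite inE ia nb => /and4P [/and3P [_ _ /eqP mod1] _ Ga _].
    have -> : phi b = b.
      case: (Hphi b) => [//|[bL]|[_ _ [w']]]; first by rewrite (negPf (Q'L _ bQ)) in bL.
      by rewrite inE => /and4P [/and3P [_ _]]; rewrite ib -addn1 -modnDml -ia mod1.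
    by rewrite /= Ga.
  pose d := ((f0 c.1.1, f0 c.1.2), (f0 c.2.1, f0 c.2.2)).
  have dcs : d \in cs' by apply: (map_f (fun c => ((f0 c.1.1, f0 c.1.2), (f0 c.2.1, f0 c.2.2)))).
  have [g1 h1 g2] := Hcs _ dcs.
  have fixo w : w \in outer c -> phi (f0 w) = f0 w.
    move=> wc; have wo : w \in flatten (map outer cs).
      by apply/flattenP; exists (outer c) => //; apply: map_f.
    have wB : f0 w \in B by rewrite inE flatten_map_outer map_f.
    case: (Hphi (f0 w)) => [//|[wL]|[_]]; last by rewrite wB.
    by rewrite (negPf (Q'L _ (fS _ (out _ wo)))) in wL.
  move: uvc; rewrite !inE => /or3P [] /eqP [-> ->] /=.
  - by rewrite fixo ?inE ?eqxx // g1.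
  - by rewrite h1 orbT.
  - by rewrite [phi (f0 c.2.2)]fixo ?inE ?eqxx ?orbT // adj_sym g2.
exists (phi \o f0); split=> [|u v auv /=]; first by apply: inj_comp f0inj; apply: perm_inj.
case/orP: (edge u v auv) => [/good//|/good H1].
by have := adj_sym (graph_union G H) (phi (f0 u)) (phi (f0 v)); rewrite /= in H1 * => ->.
Qed.

Local Open Scope ring_scope.

(** * Hits of a uniform random permutation *)

Lemma hit_factor_bounds (R : realFieldType) (a : R) :
  0 < a -> a <= 1 -> 0 <= 1 - (a / 2) ^+ 3 / 2 <= 1.
Proof.
move=> a_gt0 a_le1; have a0 : 0 <= a / 2 by lra.
have a1 : a / 2 <= 1 by lra.
have := exprn_ge0 3 a0; have := exprn_ile1 3 a0 a1; lra.
Qed.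

Section RandomPermutation.
Variables (R : realFieldType) (W : finType) (z : nat -> W) (a : R).
Hypotheses (a_gt0 : 0 < a) (a_le1 : a <= 1).
Implicit Types (g : {perm W} -> R) (A B : {set W}).

(** This stands for measurability when the values of [pi] are revealed one by one along [z]. *)
Definition depends_on_first k g :=
  forall pi pi' : {perm W}, (forall i, (i < k)%N -> pi (z i) = pi' (z i)) -> g pi = g pi'.

Definition injective_below M := forall i j, (i < M)%N -> (j < M)%N -> z i = z j -> i = j.

(** Given the first [k] values, the next one is uniform among the remaining ones: composing with the
    transposition of [z k] and an unrevealed point [x] does not affect [g], so all [x] in [P] yield
    the same sum. For every [pi], at least [#|A| - k], hence at least [a / 2 * #|W|], of these
    points are sent into [A]; averaging over [x] gives the factor [a / 2]. *)
Lemma next_value g k A :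
  (forall pi, 0 <= g pi) -> depends_on_first k g ->
  injective_below k.+1 -> k%:R <= a / 2 * #|W|%:R -> a * #|W|%:R <= #|A|%:R ->
  a / 2 * (\sum_pi g pi) <= \sum_pi g pi * (pi (z k) \in A)%:R.
Proof.
move=> g0 gk zinj ka Aa.
pose P := ~: [set z i | i : 'I_k].
have zkP : z k \in P.
  rewrite inE; apply/imsetP => -[i _ E].
  have := zinj k i (leqnn _) (ltnW (ltn_ord i)) E => ki.
  by have := ltn_ord i; rewrite -ki ltnn.
have cP : (#|~: P| <= k)%N.
  by rewrite setCK (leq_trans (leq_imset_card _ _)) // card_ord.
have zP i : (i < k)%N -> z i \notin P.
  by move=> ik; rewrite inE negbK; apply/imsetP; exists (Ordinal ik).
have swap x : x \in P -> \sum_pi g pi * (pi (z k) \in A)%:R = \sum_pi g pi * (pi x \in A)%:R.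
  move=> xP; rewrite (reindex_inj (mulgI (tperm (z k) x))) /=.
  apply: eq_bigr => pi _; rewrite permM tpermL; congr (_ * _).
  apply: gk => i ik; rewrite permM tpermD //; apply: contraTneq isT => E; have := zP i ik.
    by rewrite -E zkP.
  by rewrite -E xP.
set L := \sum_pi g pi * (pi (z k) \in A)%:R in swap *; set S := \sum_pi g pi.
have L0 : 0 <= L by apply: sumr_ge0 => pi _; rewrite mulr_ge0 ?ler0n.
have S0 : 0 <= S by apply: sumr_ge0.
have many (pi : {perm W}) : a / 2 * #|W|%:R <= \sum_(x in P) (pi x \in A)%:R :> R.
  pose A' := [set x | pi x \in A].
  have cA : #|A'| = #|A|.
    rewrite -(card_imset _ (@perm_inj _ pi)); apply: eq_card => y.
    apply/imsetP/idP => [[x]|yA]; first by rewrite inE => ? ->.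
    by exists (pi^-1%g y); rewrite ?inE permKV.
  have -> : \sum_(x in P) (pi x \in A)%:R = #|A' :&: P|%:R :> R.
    rewrite -natr_sum -big_mkcondr sum1dep_card; congr _%:R; apply: eq_card => x.
    by rewrite !inE andbC.
  have : (#|A'| <= #|A' :&: P| + k)%N.
    rewrite -(cardsID P A') leq_add2l (leq_trans _ cP) // subset_leq_card //.
    by apply/subsetP => x; rewrite !inE => /andP [].
  by rewrite cA -(ler_nat R) natrD; lra.
have W0 : 0 < #|W|%:R :> R by rewrite ltr0n; apply/card_gt0P; exists (z k).
rewrite -(ler_pM2r W0).
apply: (@le_trans _ _ (\sum_(x in P) L)); last first.
  by rewrite sumr_const -[L *+ _]mulr_natr; apply: ler_wpM2l; rewrite // ler_nat max_card.
rewrite (eq_bigr (fun x => \sum_pi g pi * (pi x \in A)%:R)) //.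
rewrite exchange_big /= mulrAC mulr_sumr; apply: ler_sum => pi _.
by rewrite -mulr_sumr mulrC; apply: ler_wpM2l.
Qed.

Definition hits A B (pi : {perm W}) j :=
  [&& pi (z (3 * j)) \in A, pi (z (3 * j).+1) \in B & pi (z (3 * j).+2) \in A].

(** This bounds the exponential moment of the number of hits. Given the earlier triples, the next
    one is hit with probability at least [(a / 2) ^+ 3], by [next_value] used three times, and a hit
    halves the weight. *)
Lemma exp_moment A B m :
  injective_below (3 * m) -> (3 * m)%:R <= a / 2 * #|W|%:R ->
  a * #|W|%:R <= #|A|%:R -> a * #|W|%:R <= #|B|%:R ->
  \sum_pi \prod_(0 <= j < m) (if hits A B pi j then 2^-1 else 1) <=
    (1 - (a / 2) ^+ 3 / 2) ^+ m * (#|W|)`!%:R.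
Proof.
move=> + + Aa Ba; elim: m => [|m IHm] zinj ma.
  rewrite expr0 mul1r (eq_bigr (fun=> 1)) => [|pi _]; last by rewrite big_nil.
  rewrite sumr_const -[#|W|]cardsT -card_perm.
  rewrite (eq_card (B := perm_on [set: W])) // => pi; rewrite [RHS]unfold_in.
  by apply/esym/subsetP => x; rewrite inE.
pose w (pi : {perm W}) := \prod_(0 <= j < m) (if hits A B pi j then 2^-1 else 1 : R).
have wE (pi : {perm W}) : \prod_(0 <= j < m.+1) (if hits A B pi j then 2^-1 else 1) =
    w pi - 2^-1 * (w pi * (pi (z (3 * m)) \in A)%:R * (pi (z (3 * m).+1) \in B)%:R * (pi (z (3 * m).+2) \in A)%:R).
  rewrite big_nat_recr //= -/(w pi) /hits.
  by do !case: (_ \in _) => /=; field.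
have w0 pi : 0 <= w pi.
  by apply: prodr_ge0 => j _; case: ifP; rewrite ?invr_ge0.
have wloc : depends_on_first (3 * m) w.
  move=> pi pi' E; apply: eq_big_nat => j /andP [_ jm]; rewrite /hits !E //; lia.
have inj k : (k <= 3 * m.+1)%N -> injective_below k.
  by move=> km i j ik jk; apply: zinj; lia.
have ak k : (k <= 3 * m.+1)%N -> k%:R <= a / 2 * #|W|%:R.
  by move=> km; apply: le_trans ma; rewrite ler_nat.
have l0 : (3 * m <= 3 * m.+1)%N by lia.
have l1 : ((3 * m).+1 <= 3 * m.+1)%N by lia.
have l2 : ((3 * m).+2 <= 3 * m.+1)%N by lia.
have l3 : ((3 * m).+3 <= 3 * m.+1)%N by lia.
have := next_value w0 wloc (inj _ l1) (ak _ l0) Aa.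
pose w1 pi := w pi * (pi (z (3 * m)) \in A)%:R; rewrite -/(\sum_pi w1 pi) => H1.
have w10 pi : 0 <= w1 pi by rewrite mulr_ge0.
have w1loc : depends_on_first (3 * m).+1 w1.
  by move=> pi pi' E; rewrite /w1 E // (wloc pi pi') // => i ik; apply: E; apply: ltnW.
have := next_value w10 w1loc (inj _ l2) (ak _ l1) Ba.
pose w2 pi := w1 pi * (pi (z (3 * m).+1) \in B)%:R; rewrite -/(\sum_pi w2 pi) => H2.
have w20 pi : 0 <= w2 pi by rewrite mulr_ge0.
have w2loc : depends_on_first (3 * m).+2 w2.
  by move=> pi pi' E; rewrite /w2 E // (w1loc pi pi') // => i ik; apply: E; apply: ltnW.
have H3 := next_value w20 w2loc (inj _ l3) (ak _ l2) Aa.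
rewrite (eq_bigr _ (fun pi _ => wE pi)) sumrB -mulr_sumr.
have IH := IHm (inj _ l0) (ak _ l0); rewrite -/w in IH.
set S := \sum_pi w pi in H1 IH *.
have H4 : (a / 2) ^+ 3 * S <= \sum_pi w2 pi * (pi (z (3 * m).+2) \in A)%:R.
  have a2 : 0 <= a / 2 by rewrite divr_ge0 // ltW.
  have -> : (a / 2) ^+ 3 * S = a / 2 * (a / 2 * (a / 2 * S)) by ring.
  apply: le_trans H3; apply: le_trans (ler_wpM2l a2 H2).
  exact: ler_wpM2l a2 _ _ (ler_wpM2l a2 H1).
have /andP [c0 _] := hit_factor_bounds a_gt0 a_le1.
rewrite [X in _ <= X * _]exprS -mulrA; apply: le_trans (ler_wpM2l c0 IH).
rewrite mulrBl mul1r lerD2l lerN2 mulrAC [in X in _ <= X]mulrC ler_pM2r ?invr_gt0 //.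
Qed.

(** Markov's inequality for 2 to the power minus the number of hits: fewer than [T] hits make this
    weight at least [2^-1 ^+ T], while its mean is at most
    [q ^+ m <= (q ^+ b) ^+ T <= 4^-1 ^+ T]. *)
Lemma few_hits A B m T b :
  injective_below (3 * m) -> (3 * m)%:R <= a / 2 * #|W|%:R ->
  a * #|W|%:R <= #|A|%:R -> a * #|W|%:R <= #|B|%:R ->
  (1 - (a / 2) ^+ 3 / 2) ^+ b <= 4^-1 -> (b * T <= m)%N ->
  #|[set pi | (#|[set j : 'I_m | hits A B pi j]| < T)%N]|%:R <= 2^-1 ^+ T * (#|W|)`!%:R :> R.
Proof.
move=> zinj ma Aa Ba bP bT; have := exp_moment zinj ma Aa Ba.
set q := 1 - _; set E := [set pi | _] => HE.
have /andP [q0 q1] : 0 <= q <= 1 by exact: hit_factor_bounds.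
have prodE (pi : {perm W}) : \prod_(0 <= j < m) (if hits A B pi j then 2^-1 else 1) =
    2^-1 ^+ #|[set j : 'I_m | hits A B pi j]| :> R.
  rewrite big_mkord -big_mkcond prodr_const; congr (_ ^+ _).
  by apply: eq_card => j; rewrite inE.
have lb : #|E|%:R * 2^-1 ^+ T <= q ^+ m * (#|W|)`!%:R.
  apply: le_trans HE; rewrite (bigID (mem E)) /=.
  apply: (@le_trans _ _ (\sum_(pi in E) 2^-1 ^+ T)).
    by rewrite sumr_const mulr_natl.
  rewrite -[X in X <= _]addr0; apply: lerD; last first.
    by apply: sumr_ge0 => pi _; rewrite prodE exprn_ge0 // invr_ge0.
  apply: ler_sum => pi; rewrite inE prodE => /ltnW lt.
  by apply: ler_wiXn2l lt; lra.
have : q ^+ m <= 2^-1 ^+ T * 2^-1 ^+ T.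
  apply: (@le_trans _ _ (q ^+ (b * T))); first exact: ler_wiXn2l.
  rewrite -exprMn exprM; apply: lerXn2r; rewrite ?nnegrE ?exprn_ge0 //; lra.
move=> /(ler_wpM2r (ler0n R (#|W|)`!)) /(le_trans lb).
rewrite [X in X <= _]mulrC -mulrA ler_pM2l ?exprn_gt0 // invr_gt0 ltr0n //.
Qed.

End RandomPermutation.

Lemma leq_card_bigcup (I T : finType) (F : I -> {set T}) :
  (#|\bigcup_i F i| <= \sum_i #|F i|)%N.
Proof.
elim/big_ind2: _ => [|A m B n lA lB|//]; first by rewrite cards0.
by rewrite (leq_trans (leq_card_setU _ _)) // leq_add.
Qed.

(** * Many middles for all pairs of vertices *)

Section RandomMiddles.
Variables (R : realFieldType) (W : finType) (a : R) (G : sgraph W).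
Hypotheses (a_gt0 : 0 < a) (a_le1 : a <= 1).
Hypothesis G_deg : forall v, a * #|W|%:R <= (deg G v)%:R.

(** A hit [j] gives the middle at position [3 * j + 1] of the relabelled path, and distinct [j] give
    distinct middles. *)
Lemma middles_of_hits (Q : seq W) x0 m (pi : {perm W}) u v :
  uniq Q -> (3 * m <= size Q)%N ->
  (#|[set j : 'I_m | hits (nth x0 Q) [set x | adj G v x] [set x | adj G u x] pi j]|
    <= #|middles (adj G) (map pi Q) m u v|)%N.
Proof.
move=> uQ mQ; have uQ' : uniq (map pi Q) by rewrite (map_inj_uniq (@perm_inj _ pi)).
rewrite -(card_in_imset (f := fun j : 'I_m => pi (nth x0 Q (3 * j).+1))); last first.
  move=> i j _ _ /perm_inj /eqP; have := ltn_ord i; have := ltn_ord j => jm im.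
  rewrite nth_uniq ?(leq_trans _ mQ) //; [|lia|lia].
  by move=> /eqP E; apply: val_inj => /=; lia.
apply: subset_leq_card; apply/subsetP => y /imsetP [j]; rewrite inE => hj ->{y}.
have jm := ltn_ord j.
have nE i x : (i < size Q)%N -> pi (nth x0 Q i) = nth x (map pi Q) i.
  by move=> iQ; rewrite (nth_map x0).
have i1 : ((3 * j).+1 < size Q)%N by apply: leq_trans mQ; lia.
have idx : index (pi (nth x0 Q (3 * j).+1)) (map pi Q) = (3 * j).+1.
  by rewrite (nE _ x0) // index_uniq // size_map.
case/and3P: hj; rewrite !inE /is_middle idx map_f ?mem_nth //= => h0 h1 h2.
rewrite -!nE ?h0 ?h1 ?h2 ?andbT /=; [|by apply: leq_trans mQ; lia|by apply: leq_trans mQ; lia].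
by apply/andP; split; lia.
Qed.

(** Union bound over the pairs [u], [v], with [few_hits] applied to the neighbourhoods of [v] and
    [u]. *)
Lemma random_middles (Q : seq W) m T b :
  uniq Q -> (3 * m <= size Q)%N -> (3 * m)%:R <= a / 2 * #|W|%:R ->
  (1 - (a / 2) ^+ 3 / 2) ^+ b <= 4^-1 -> (b * T <= m)%N ->
  #|[set pi : {perm W} | ~~ [forall u, forall v,
      (T <= #|middles (adj G) (map pi Q) m u v|)%N]]|%:R <=
    #|W|%:R ^+ 2 * 2^-1 ^+ T * (#|W|)`!%:R :> R.
Proof.
move=> uQ mQ ma bP bT.
case: (pickP W) => [x0 _|W0]; last first.
  rewrite (_ : [set _ | _] = set0); first by rewrite cards0 !mulr_ge0 ?exprn_ge0 ?invr_ge0.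
  apply/setP => pi; rewrite !inE; apply/negbTE; rewrite negbK.
  by apply/forallP => u; have := W0 u.
pose Bad u v := [set pi : {perm W} | (#|[set j : 'I_m |
  hits (nth x0 Q) [set x | adj G v x] [set x | adj G u x] pi j]| < T)%N].
apply: (@le_trans _ _ (\sum_(u : W) \sum_(v : W) #|Bad u v|%:R)).
  under eq_bigr do rewrite -natr_sum.
  rewrite -natr_sum ler_nat pair_big /=.
  apply: leq_trans (leq_card_bigcup (fun p : W * W => Bad p.1 p.2)).
  apply: subset_leq_card; apply/subsetP => pi; rewrite inE negb_forall => /existsP [u].
  rewrite negb_forall => /existsP [v]; rewrite -ltnNge => few.
  apply/bigcupP; exists (u, v) => //; rewrite inE.
  exact: leq_ltn_trans (middles_of_hits x0 pi u v uQ mQ) few.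
apply: (@le_trans _ _ (\sum_(u : W) \sum_(v : W) (2^-1 ^+ T * (#|W|)`!%:R))).
  apply: ler_sum => u _; apply: ler_sum => v _; apply: (few_hits a_gt0 a_le1) bP bT => //.
  - move=> i j im jm /eqP; rewrite nth_uniq => [/eqP //|||//]; exact: leq_trans mQ.
  - by apply: le_trans (G_deg v) _; rewrite ler_nat cardsE.
  - by apply: le_trans (G_deg u) _; rewrite ler_nat cardsE.
rewrite !sumr_const; set c := 2^-1 ^+ T * _.
by rewrite -[c *+ _ *+ _]mulr_natl -[c *+ _]mulr_natl expr2 -!mulrA.
Qed.
End RandomMiddles.

(** * The binomial random graph: joinedness and invariance under relabelling *)

Section Gnp.
Variables (R : realType) (n : nat) (p : R).
Hypothesis p01 : 0 <= p <= 1.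
Implicit Types (E C : {set {set 'I_n}}) (A B : {set 'I_n}) (pi : {perm 'I_n}).

Lemma gnp_weight_ge0 E : 0 <= gnp_weight p E.
Proof.
apply: prodr_ge0 => e _; case/andP: p01 => p0 p1.
by case: ifP => // _; rewrite subr_ge0.
Qed.

(** Expand the product of all [f e + g e] over subsets [E]. Factors equal [1 - p] on [C] and 1
    elsewhere, and since [f] vanishes outside [pairs n :\: C], only the sets [E] of pairs avoiding
    [C] contribute. *)
Lemma gnp_avoid C : C \subset pairs n ->
  \sum_(E in powerset (pairs n) | E :&: C == set0) gnp_weight p E = (1 - p) ^+ #|C|.
Proof.
move=> Cp.
pose f (e : {set 'I_n}) := if e \in pairs n :\: C then p else 0 : R.
pose g (e : {set 'I_n}) := if e \in pairs n then 1 - p else 1 : R.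
have : \prod_e (f e + g e) = \sum_(E in {set {set 'I_n}}) \prod_e (if e \in E then f e else g e).
  exact: bigA_distr.
rewrite (bigID (mem C)) /= (eq_bigr (fun=> 1 - p)); last first.
  by move=> e eC; rewrite /f /g inE eC (subsetP Cp) // add0r.
rewrite prodr_const [X in _ * X]big1 ?mulr1; last first.
  move=> e eC; rewrite /f /g inE (negPf eC) /=; case: ifP => _; last by rewrite add0r.
  by rewrite addrC subrK.
move=> ->; rewrite [RHS](bigID (fun E : {set {set 'I_n}} => E \subset pairs n :\: C)) /=.
rewrite [X in _ = _ + X]big1 ?addr0.
  apply: eq_big => E.
    by rewrite inE subsetD -setI_eq0.
  rewrite inE => /andP [Ep /eqP EC]; rewrite /gnp_weight big_mkcond /=.
  apply: eq_bigr => e _; rewrite /f /g in_setD.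
  case eE: (e \in E) => //.
  have -> : e \in pairs n by exact: (subsetP Ep _ eE).
  have -> : e \notin C by apply/negP => eC; have := in_set0 e; rewrite -EC inE eE eC.
  by [].
move=> E /subsetPn [e eE eD]; rewrite (bigD1 e) //= eE /f (negPf eD) mul0r //.
Qed.

Lemma gnp_total : \sum_(E in powerset (pairs n)) gnp_weight p E = 1.
Proof.
have := gnp_avoid (sub0set _); rewrite cards0 expr0 => <-.
by apply: eq_bigl => E; rewrite setI0 eqxx andbT.
Qed.

Definition cross A B := [set [set x.1; x.2] | x in setX A B].

Lemma cross_sub A B : [disjoint A & B] -> cross A B \subset pairs n.
Proof.
move=> dAB; apply/subsetP => e /imsetP [[a b]]; rewrite inE /= => /andP [aA bB] ->.
rewrite inE cards2; suff -> : a != b by [].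
by apply: contraTneq bB => <-; rewrite (disjointFr dAB).
Qed.

Lemma card_cross A B : [disjoint A & B] -> #|cross A B| = (#|A| * #|B|)%N.
Proof.
move=> dAB; rewrite card_in_imset ?cardsX // => -[a b] [a' b'].
rewrite !inE /= => /andP [aA bB] /andP [a'A b'B] /setP E.
have nA x : x \in B -> x \in A = false by move=> xB; rewrite (disjointFl dAB).
have /esym := E a; rewrite !inE eqxx /= => /orP [/eqP|/eqP] Ea; last first.
  by rewrite Ea nA in aA.
have /esym := E b; rewrite !inE eqxx orbT => /orP [/eqP|/eqP] Eb; last by rewrite Ea Eb.
by rewrite Eb in bB; rewrite (nA _ bB) in a'A.
Qed.

(** Union bound over the at most [4 ^ n] pairs of sets: disjoint [A] and [B] span no edge with
    probability [(1 - p) ^+ (#|A| * #|B|)]. *)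
Lemma gnp_not_joined s :
  \sum_(E in powerset (pairs n) | ~~ `[< joined s (adj (graph_of_edges E)) >]) gnp_weight p E
    <= 4 ^+ n * (1 - p) ^+ (s * s).
Proof.
pose big_pair (AB : {set 'I_n} * {set 'I_n}) :=
  [&& [disjoint AB.1 & AB.2], (s <= #|AB.1|)%N & (s <= #|AB.2|)%N].
pose missed E (AB : {set 'I_n} * {set 'I_n}) := E :&: cross AB.1 AB.2 == set0.
have p1 : 0 <= 1 - p <= 1 by case/andP: p01 => *; apply/andP; split; lra.
have bound E : ~~ `[< joined s (adj (graph_of_edges E)) >] ->
    exists AB, big_pair AB && missed E AB.
  move=> /asboolPn nj; apply: contrapT => none; apply: nj => A B dAB sA sB.
  apply: contrapT => noe; apply: none; exists (A, B); rewrite /big_pair /= dAB sA sB /=.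
  apply/eqP/setP => e; rewrite !inE; apply/negP => /andP [eE /imsetP [[a b]]].
  rewrite inE /= => /andP [aA bB] /= eab; apply: noe; exists a, b; split=> //=.
  rewrite /edge_rel /= -eab eE andbT; apply: contraTneq bB => <-; by rewrite (disjointFr dAB).
apply: (@le_trans _ _ (\sum_(E in powerset (pairs n)) \sum_(AB | big_pair AB && missed E AB) gnp_weight p E)).
  rewrite big_mkcondr /=; apply: ler_sum => E _; case: ifP => [/bound [AB ABP]|_].
    rewrite (bigD1 AB) //= lerDl; apply: sumr_ge0 => *; exact: gnp_weight_ge0.
  by apply: sumr_ge0 => *; exact: gnp_weight_ge0.
under eq_bigr do rewrite big_mkcondr.
rewrite exchange_big /=; under eq_bigr do rewrite -big_mkcondr.
apply: (@le_trans _ _ (\sum_(AB : {set 'I_n} * {set 'I_n} | big_pair AB) (1 - p) ^+ (s * s))).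
  apply: ler_sum => -[A B] /and3P [/= dAB sA sB].
  rewrite gnp_avoid ?cross_sub // card_cross //.
  by case/andP: p1 => *; apply: ler_wiXn2l => //; apply: leq_mul.
rewrite sumr_const -[X in X <= _]mulr_natl; apply: ler_wpM2r; first by rewrite exprn_ge0 //; case/andP: p1.
rewrite -natrX ler_nat (leq_trans (max_card _)) // card_prod -cardsT -powersetT card_powerset.
by rewrite cardsT card_ord -expnMn.
Qed.

Definition relabel pi E := [set [set pi x | x in e] | e : {set 'I_n} in E].

Lemma relabel_inj pi : injective (relabel pi).
Proof. exact: imset_inj (imset_inj (@perm_inj _ pi)). Qed.

Lemma mem_relabel pi E (e : {set 'I_n}) : ([set pi x | x in e] \in relabel pi E) = (e \in E).
Proof. by rewrite mem_imset //; apply: imset_inj; apply: perm_inj. Qed.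

Lemma adj_relabel pi E u v :
  adj (graph_of_edges (relabel pi E)) (pi u) (pi v) = adj (graph_of_edges E) u v.
Proof.
rewrite /= /edge_rel /= (inj_eq (@perm_inj _ pi)).
have -> : [set pi u; pi v] = [set pi x | x in [set u; v]] by rewrite imsetU1 imset_set1.
by rewrite mem_relabel.
Qed.

Lemma pairs_relabel pi : relabel pi (pairs n) = pairs n.
Proof.
apply/eqP; rewrite eqEcard card_imset ?leqnn ?andbT; last by apply: imset_inj; apply: perm_inj.
apply/subsetP => e /imsetP [e' ]; rewrite !inE => /eqP c2 ->.
by rewrite card_imset ?c2 //; apply: perm_inj.
Qed.

Lemma gnp_weight_relabel pi E : gnp_weight p (relabel pi E) = gnp_weight p E.
Proof.
rewrite /gnp_weight -{1}(pairs_relabel pi) big_imset /=; last first.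
  by move=> e e' _ _; apply: imset_inj; apply: perm_inj.
by apply: eq_bigr => e _; rewrite mem_relabel.
Qed.

Lemma gnp_prob_relabel pi (P : sgraph 'I_n -> Prop) :
  gnp_prob p P =
  \sum_(E in powerset (pairs n) | `[< P (graph_of_edges (relabel pi E)) >]) gnp_weight p E.
Proof.
rewrite /gnp_prob (reindex_inj (@relabel_inj pi)) /=; apply: eq_big => [E|E _].
  congr (_ && _); rewrite !inE -{1}(pairs_relabel pi).
  apply/subsetP/subsetP => H e; first by rewrite -(mem_relabel pi) => /H; rewrite mem_relabel.
  by move=> /imsetP [e' /H e'p ->]; rewrite mem_relabel.
exact: gnp_weight_relabel.
Qed.

Lemma gnp_prob_le1 (P : sgraph 'I_n -> Prop) : gnp_prob p P <= 1.
Proof.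
rewrite -gnp_total [X in _ <= X](bigID (fun E => `[< P (graph_of_edges E) >])) /=.
by rewrite lerDl; apply: sumr_ge0 => *; exact: gnp_weight_ge0.
Qed.

(** By invariance the probability equals its average over all relabellings. Exchanging the two sums,
    each joined [E] contributes at least the proportion [1 - delta] of its weight, and
    [gnp_not_joined] bounds the weight of the other [E]. *)
Lemma gnp_prob_ge (P : sgraph 'I_n -> Prop) s (delta : R) :
  0 <= delta ->
  (forall E, joined s (adj (graph_of_edges E)) ->
    #|[set pi : {perm 'I_n} | ~~ `[< P (graph_of_edges (relabel pi E)) >]]|%:R <= delta * n`!%:R) ->
  1 - delta - 4 ^+ n * (1 - p) ^+ (s * s) <= gnp_prob p P.
Proof.
move=> d0 few.
have f0 : 0 < n`!%:R :> R by rewrite ltr0n fact_gt0.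
have cS : #|{perm 'I_n}| = n`! by rewrite card_Sn.
rewrite -(ler_pM2l f0).
have -> : n`!%:R * gnp_prob p P = \sum_(E in powerset (pairs n))
    #|[set pi | `[< P (graph_of_edges (relabel pi E)) >]]|%:R * gnp_weight p E.
  transitivity (\sum_(pi : {perm 'I_n}) gnp_prob p P).
    by rewrite sumr_const cS mulr_natl.
  under eq_bigr => pi _ do rewrite (gnp_prob_relabel pi) big_mkcondr.
  rewrite exchange_big /=; apply: eq_bigr => E _.
  by rewrite -big_mkcond sumr_const mulr_natl; congr (_ *+ _); apply: eq_card => pi; rewrite !inE.
pose J E := `[< joined s (adj (graph_of_edges E)) >].
set bad := 4 ^+ n * _.
set good := \sum_(E in powerset (pairs n) | J E) gnp_weight p E.
have goodE : 1 - bad <= good.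
  rewrite lerBlDr -[X in X <= _]gnp_total (bigID J) /= lerD2l; exact: gnp_not_joined.
have good1 : good <= 1.
  by rewrite -gnp_total [X in _ <= X](bigID J) /= lerDl; apply: sumr_ge0 => *; exact: gnp_weight_ge0.
apply: (@le_trans _ _ (n`!%:R * ((1 - delta) * good))).
  rewrite ler_pM2l // mulrBl mul1r.
  have := ler_wpM2l d0 good1; lra.
rewrite [X in _ <= X](bigID J) /= mulrA mulr_sumr -[X in X <= _]addr0; apply: lerD; last first.
  by apply: sumr_ge0 => E _; rewrite mulr_ge0 ?gnp_weight_ge0.
apply: ler_sum => E /andP [_ /asboolP JE]; apply: ler_wpM2r; first exact: gnp_weight_ge0.
have := few E JE; have := cardsC [set pi | `[< P (graph_of_edges (relabel pi E)) >]].
rewrite cS => /(congr1 (fun k => k%:R : R)); rewrite natrD.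
rewrite (_ : ~: _ = [set pi | ~~ `[< P (graph_of_edges (relabel pi E)) >]]); last first.
  by apply/setP => pi; rewrite !inE.
lra.
Qed.

End Gnp.

Lemma joined_relabel n (s : nat) (pi : {perm 'I_n}) (E : {set {set 'I_n}}) :
  joined s (adj (graph_of_edges E)) -> joined s (adj (graph_of_edges (relabel pi E))).
Proof.
move=> jE A B dAB sA sB.
have pre (D : {set 'I_n}) : #|pi @^-1: D| = #|D|.
  rewrite -(card_imset _ (@perm_inj _ pi)); apply: eq_card => y.
  apply/imsetP/idP => [[x]|yD]; first by rewrite inE => ? ->.
  by exists (pi^-1%g y); rewrite ?inE permKV.
have [|||x [y [xA yB xy]]] := jE (pi @^-1: A) (pi @^-1: B).
- rewrite disjoint_subset; apply/subsetP => x; rewrite !inE => xA.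
  by rewrite (disjointFr dAB).
- by rewrite pre.
- by rewrite pre.
exists (pi x), (pi y); rewrite adj_relabel; split=> //; [move: xA|move: yB]; by rewrite inE.
Qed.

Lemma sorted_relabel n (pi : {perm 'I_n}) (E : {set {set 'I_n}}) Q :
  sorted (adj (graph_of_edges E)) Q ->
  sorted (adj (graph_of_edges (relabel pi E))) (map pi Q).
Proof.
case: Q => //= x Q; rewrite path_map; apply: sub_path => u v uv.
have : adj (graph_of_edges (relabel pi E)) (pi u) (pi v) by rewrite adj_relabel.
exact.
Qed.

(** * Numerical estimates and the bound for a fixed number of vertices *)

Lemma min_degree_le (V : finType) (G : sgraph V) v : (min_degree G <= deg G v)%N.
Proof.
rewrite /min_degree; have : v \in index_enum V by rewrite mem_index_enum.
elim: (index_enum V) => // u r IHr; rewrite inE big_cons => /orP [/eqP->|/IHr]; first exact: geq_minl.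
by apply: leq_trans; apply: geq_minr.
Qed.

(** A rational substitute for the exponential bound on [(1 - x) ^+ k]; it rests on
    [(1 - x) * (1 + (k + 1) * x) <= 1 + k * x]. *)
Lemma expr_1mx_le (R : realFieldType) (x : R) k :
  0 <= x <= 1 -> (1 - x) ^+ k * (1 + k%:R * x) <= 1.
Proof.
case/andP=> x0 x1; elim: k => [|k IHk]; first by rewrite expr0 mul1r mul0r addr0.
apply: le_trans IHk; rewrite exprSr -mulrA; apply: ler_wpM2l.
  by rewrite exprn_ge0 // subr_ge0.
rewrite -natr1 -subr_ge0.
have -> : 1 + k%:R * x - (1 - x) * (1 + (k%:R + 1) * x) = (k%:R + 1) * x ^+ 2 by ring.
by rewrite mulr_ge0 ?exprn_ge0 // addr_ge0.
Qed.

Lemma cube_le_exp2 k : (k.+1 ^ 3 <= 8 * 2 ^ k)%N.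
Proof.
(* The cube at most doubles only when going from 4 to 5 and later, so the first values are checked
   directly; the bound is attained at [k = 3]. *)
elim: k => // k IHk; case: k IHk => [//|[//|[//|k]]] IHk.
rewrite [(2 ^ k.+4)%N]expnS mulnCA; apply: leq_trans (leq_mul (leqnn 2) IHk).
by rewrite !expnS !expn0; nia.
Qed.

(** Here [c] is [B * b] and [12 * c] is [l0]: the hypotheses say that [2 * l0 * s] and [3 * m] are
    at most [n / 2], [l0] at most [n / 8], and [T] about [n / c]. *)
Lemma universal_numbers (n c m s T : nat) :
  (0 < c)%N -> (96 * c <= n)%N -> (6 * m <= n)%N -> (s * (4 * (12 * c)) <= n)%N ->
  (n < T.+1 * c)%N ->
  [/\ 2 * (12 * c) * s + 12 * c <= n, 12 * c * (3 * m) + 2 * n <= 12 * c * n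
    & 4 * n + 2 * (12 * c) * s <= 12 * c * T]%N.
Proof.
move=> c0 cn mn sn nT; split; [lia| |lia].
have h1 := leq_mul (leqnn c) mn; have h2 := leq_mul c0 (leqnn n); lia.
Qed.

(** The parameters are linear in [n]. Taking [m = n %/ B] with [6 <= a * B] gives
    [3 * m <= a / 2 * n]; [T = n %/ (B * b)] gives [b * T <= m], as [few_hits] requires;
    [s = n %/ (4 * l0)] is small compared with [T]. *)
Lemma universal_prob_ge (R : realType) (a p : R) (n l B b l0 : nat) (G : sgraph 'I_n) :
  0 < a -> a <= 1 -> 0 <= p <= 1 -> 6 <= a * B%:R ->
  (0 < b)%N -> (1 - (a / 2) ^+ 3 / 2) ^+ b <= 4^-1 ->
  l0 = (12 * B * b)%N -> (l0 <= l)%N -> (8 * l0 <= n)%N ->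
  a * n%:R <= (min_degree G)%:R ->
  1 - n%:R ^+ 2 * 2^-1 ^+ (n %/ (B * b))
    - 4 ^+ n * (1 - p) ^+ (n %/ (4 * l0) * (n %/ (4 * l0))) <=
  gnp_prob p (fun H => universal (bounded_degree_girth l n 2) (graph_union G H)).
Proof.
move=> a0 a1 p01 aB b0 qb l0E l0l nbig Gdeg.
set T := (n %/ (B * b))%N; set s := (n %/ (4 * l0))%N; set m := (n %/ B)%N.
have B6 : (6 <= B)%N.
  rewrite -(ler_nat R); apply: le_trans aB _; by rewrite ler_piMl.
have Bb0 : (0 < B * b)%N by rewrite muln_gt0 b0; lia.
have l0_gt2 : (72 <= l0)%N by rewrite l0E; nia.
have mB : (m * B <= n)%N by exact: leq_trunc_div.
have s4 : (s * (4 * l0) <= n)%N by exact: leq_trunc_div.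
have nT : (n < T.+1 * (B * b))%N by exact: ltn_ceil.
have bT : (b * T <= m)%N.
  by rewrite leq_divRL ?(leq_trans _ B6) // mulnC mulnA mulnC (mulnC B) (mulnC b) leq_trunc_div.
apply: (gnp_prob_ge p01) => [|E jE]; first by apply: mulr_ge0; rewrite exprn_ge0 // invr_ge0.
have [Q [uQ sQ szQ]] := joined_long_path (adj_sym (graph_of_edges E)) jE.
rewrite card_ord in szQ.
have degG v : a * #|'I_n|%:R <= (deg G v)%:R.
  by rewrite card_ord; apply: le_trans Gdeg _; rewrite ler_nat min_degree_le.
have m6 : (6 * m <= n)%N by rewrite mulnC (leq_trans _ mB) // leq_mul2l B6 orbT.
have s288 : (288 * s <= n)%N.
  by apply: leq_trans s4; rewrite mulnC leq_mul2l; apply/orP; right; lia.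
have szQ' : (3 * m <= size Q)%N.
  rewrite -(leq_add2r (2 * s)); apply: leq_trans szQ; lia.
have ma : (3 * m)%:R <= a / 2 * #|'I_n|%:R.
  rewrite card_ord natrM.
  have h1 : 6 * m%:R <= a * B%:R * m%:R by apply: ler_wpM2r aB.
  have h2 : a * (m%:R * B%:R) <= a * n%:R.
    by rewrite -natrM; apply: ler_wpM2l; [exact: ltW|rewrite ler_nat].
  lra.
have := random_middles a0 a1 degG uQ szQ' ma qb bT; rewrite card_ord.
apply: le_trans; rewrite ler_nat; apply: subset_leq_card; apply/subsetP => pi; rewrite !inE.
apply: contra => /forallP mid; apply/asboolP.
have mid' u v : (T <= #|middles (adj G) (map pi Q) m u v|)%N by have /forallP := mid u; apply.
have [num1 num2 num3] : [/\ 2 * l0 * s + l0 <= n, l0 * (3 * m) + 2 * n <= l0 * n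
    & 4 * n + 2 * l0 * s <= l0 * T]%N.
  have l0c : l0 = (12 * (B * b))%N by rewrite l0E mulnA.
  rewrite l0c; apply: universal_numbers => //; rewrite -?l0c //.
  by move: nbig; rewrite l0c mulnA.
have := @universal_of_middles _ G (graph_of_edges (relabel pi E)) s m T l0 l (map pi Q)
  (@joined_relabel _ _ pi _ jE).
rewrite (map_inj_uniq (@perm_inj _ pi)) size_map card_ord; apply=> //.
- exact: sorted_relabel.
- by rewrite l0l andbT; apply: leq_trans l0_gt2.
Qed.

(** With [k = n %/ c], one has [n <= k.+1 * c], so [n ^ 3 <= 8 * c ^ 3 * 2 ^ k] by
    [cube_le_exp2]. *)
Lemma middles_error_le (R : realFieldType) (n c : nat) :
  (0 < c)%N -> (0 < n)%N ->
  n%:R ^+ 2 * 2^-1 ^+ (n %/ c) <= (8 * c ^ 3)%:R / n%:R :> R.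
Proof.
move=> c0 n0; rewrite ler_pdivlMr ?ltr0n // mulrAC exprVn ler_pdivrMr ?exprn_gt0 //.
rewrite -exprSr -!natrX -natrM ler_nat.
have le_n : (n <= (n %/ c).+1 * c)%N by apply: ltnW; apply: ltn_ceil.
apply: (@leq_trans (((n %/ c).+1 * c) ^ 3)); first by rewrite leq_exp2r.
by rewrite expnMn [leqRHS]mulnAC leq_mul2r cube_le_exp2 orbT.
Qed.

(** Since [n <= 8 * l0 * s], the assumption gives [M <= s * p], so [(1 - p) ^+ s <= M^-1]. Raising
    this to the power [s] gives at most [8 ^+ n] inverted, by the choice of [M], which beats
    [4 ^+ n] by a factor [2 ^+ n >= n]. *)
Lemma not_joined_error_le (R : realFieldType) (p : R) (n l0 : nat) :
  0 <= p <= 1 -> (0 < l0)%N -> (8 * l0 <= n)%N ->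
  (8 ^ (8 * l0) * (8 * l0))%:R <= p * n%:R ->
  4 ^+ n * (1 - p) ^+ (n %/ (4 * l0) * (n %/ (4 * l0))) <= n%:R^-1.
Proof.
move=> p01 l00 nbig pn; set s := (n %/ (4 * l0))%N; set M := (8 ^ (8 * l0))%N in pn.
have /andP [p0 p1] := p01.
have c0 : (0 < 4 * l0)%N by rewrite muln_gt0.
have s2 : (2 <= s)%N by rewrite leq_divRL //; lia.
have ns : (n <= 8 * l0 * s)%N.
  have := ltn_ceil n c0; rewrite -/s => lt; nia.
have n0 : (0 < n)%N by lia.
have M0 : 0 < M%:R :> R by rewrite ltr0n expn_gt0.
have Msp : M%:R <= s%:R * p.
  have l8 : 0 < (8 * l0)%:R :> R by rewrite ltr0n muln_gt0.
  rewrite -(ler_pM2r l8) -natrM; apply: le_trans pn _.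
  by rewrite mulrC mulrAC; apply: ler_wpM2r => //; rewrite -natrM ler_nat mulnC.
have q0 : 0 <= 1 - p by rewrite subr_ge0.
have small : (1 - p) ^+ s <= M%:R^-1.
  rewrite -[_^-1]mul1r ler_pdivlMr //; apply: le_trans (expr_1mx_le s p01).
  apply: ler_wpM2l; first exact: exprn_ge0.
  by apply: le_trans Msp _; rewrite lerDr.
have : (1 - p) ^+ (s * s) <= (8 ^+ n)^-1.
  rewrite exprM; apply: le_trans (_ : M%:R^-1 ^+ s <= _).
    by apply: lerXn2r => //; rewrite nnegrE ?exprn_ge0 // invr_ge0 ltW.
  rewrite exprVn lef_pV2 ?posrE ?exprn_gt0 //.
  by rewrite -!natrX ler_nat -expnM leq_exp2l.
move=> /(ler_wpM2l (exprn_ge0 n (ler0n R 4))) /le_trans; apply.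
rewrite ler_pdivrMr ?exprn_gt0 // mulrC ler_pdivlMr ?ltr0n //.
have -> : 8 ^+ n = 4 ^+ n * 2 ^+ n :> R by rewrite -exprMn; congr (_ ^+ n); ring.
apply: ler_wpM2l; first exact: exprn_ge0.
by rewrite -natrX ler_nat ltnW // ltn_expl.
Qed.

(** * Choice of constants and passage to the limit *)

Local Open Scope classical_set_scope.

Theorem theorem1p3 (R : realType) (alpha : R) (alpha_gt0 : 0 < alpha) :
  exists l0 : nat, (0 < l0)%N /\
    forall l : nat, (l0 <= l)%N ->
    forall p : nat -> R,
      (forall n, 0 <= p n <= 1) ->
      p n * n%:R @[n --> \oo] --> +oo ->
    forall G : forall n : nat, sgraph 'I_n,
      (\forall n \near \oo, alpha * n%:R <= (min_degree (G n))%:R) ->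
      gnp_prob (p n) (fun H : sgraph 'I_n =>
          universal (bounded_degree_girth l n 2) (graph_union (G n) H))
        @[n --> \oo] --> (1 : R).
Proof.
(* Lowering [alpha] to at most 1 keeps the degree condition and makes [hit_factor_bounds]
   available. *)
pose a := Num.min alpha 1.
have a0 : 0 < a by rewrite lt_min alpha_gt0 ltr01.
have a1 : a <= 1 by rewrite ge_min lexx orbT.
pose B := Num.bound (6 / a).
have aB : 6 <= a * B%:R.
  by rewrite mulrC -ler_pdivrMr // ltW // archi_boundP // divr_ge0 // ltW.
pose d := (a / 2) ^+ 3 / 2.
have d0 : 0 < d by rewrite divr_gt0 // exprn_gt0 // divr_gt0.
have d01 : 0 <= d <= 1.
  by have := hit_factor_bounds a0 a1; rewrite -/d; move/andP => [? _]; apply/andP; split; lra.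
(* From [3 < b * d], [expr_1mx_le] gives [(1 - d) ^+ b <= 1 / (1 + b * d) <= 4^-1]. *)
pose b := Num.bound (3 / d).
have db : 3 < b%:R * d by rewrite -ltr_pdivrMr // archi_boundP // divr_ge0 // ltW.
have b0 : (0 < b)%N by case: (b) db => // ; rewrite mul0r; lra.
have qb : (1 - d) ^+ b <= 4^-1.
  rewrite -[_^-1]mul1r ler_pdivlMr //; apply: le_trans (expr_1mx_le b d01).
  apply: ler_wpM2l; [by rewrite exprn_ge0 // subr_ge0; case/andP: d01|lra].
have B0 : (0 < B)%N by case: (B) aB => //; rewrite mulr0; lra.
exists (12 * B * b)%N; split; first by rewrite !muln_gt0 B0 b0.
set l0 := (12 * B * b)%N => l l0l p p01 pn G Gdeg.
have l00 : (0 < l0)%N by rewrite !muln_gt0 B0 b0.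
(* The two error terms are at most [(8 * (B * b) ^ 3) / n] and [1 / n], so their sum is at most
   [K / n]. *)
pose K : R := (8 * (B * b) ^ 3)%:R + 1.
have K0 : 0 < K by rewrite ltr_wpDl.
apply/cvgrPdist_le => eps eps0; near=> n.
rewrite ger0_norm ?subr_ge0 ?gnp_prob_le1 //.
have nbig : (8 * l0 <= n)%N by near: n; apply: nbhs_infty_ge.
have n0 : (0 < n)%N by apply: leq_trans nbig; rewrite muln_gt0.
have Gn : a * n%:R <= (min_degree (G n))%:R.
  apply: (@le_trans _ _ (alpha * n%:R)); last by near: n.
  by rewrite ler_wpM2r // ge_min lexx.
have := universal_prob_ge a0 a1 (p01 n) aB b0 qb erefl l0l nbig Gn.
have Bb0 : (0 < B * b)%N by rewrite muln_gt0 B0.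
have e1 := middles_error_le R Bb0 n0.
(* The left side depends on [alpha] only, so it is eventually exceeded because [p n * n] tends to
   infinity. *)
have big : (8 ^ (8 * l0) * (8 * l0))%:R <= p n * n%:R.
  by near: n; move/cvgryPge: pn; apply.
have e2 := not_joined_error_le (p01 n) l00 nbig big.
have e3 : K / n%:R <= eps.
  rewrite ler_pdivrMr ?ltr0n // mulrC -ler_pdivrMr //.
  near: n; exists (Num.bound (K / eps)) => // k /= le_k.
  apply: (@le_trans _ _ (Num.bound (K / eps))%:R); last by rewrite ler_nat.
  by rewrite ltW // archi_boundP // divr_ge0 // ltW.
move: e3; rewrite /K mulrDl mul1r => e3 low.
set P := gnp_prob _ _ in low *.
rewrite lerBlDr -lerBlDl; apply: le_trans _ low.
rewrite -addrA -opprD lerD2l lerN2; apply: le_trans e3; exact: lerD.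
Unshelve. all: by end_near.
Qed.
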